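(* Let $K\ge1$, $K'\ge0$, let $p\ge1$ be an integer, and let $F$ be a $(K,K')$-elliptic polyharmonic mapping in $\mathbb{D}$ of the form $$F(z)=a_0+\sum_{k=1}^p|z|^{2(k-1)}\sum_{n=1}^\infty\left(a_{n,k}z^n+\overline{b_{n,k}z^n}\right),$$ such that, for every $n\ge1$ and all $k_1,k_2,k_3,k_4\in\{1,\dots,p\}$, all non-zero coefficients $a_{n,k_1},a_{n,k_2}$ and $b_{n,k_3},b_{n,k_4}$ satisfy $$\left|\arg\frac{a_{n,k_1}}{a_{n,k_2}}\right|\le\frac{\pi}{2}\quad\text{and}\quad\left|\arg\frac{b_{n,k_3}}{b_{n,k_4}}\right|\le\frac{\pi}{2}.$$ Suppose $\lambda_F(z)\le\lambda$ for all $z\in\mathbb{D}$, where $\lambda$ is a constant, and $F(0)=0$, $J_F(0)=1$. Then $$|a_{n,k}|+|b_{n,k}|\le\frac{\sqrt{(K^2+1)\lambda^2+2K\sqrt{K'}\lambda+K'-\frac{1}{K+K'}}}{n}\quad\text{for all } n\ge2,\ k=1,$$ $$|a_{n,k}|+|b_{n,k}|\le\frac{\sqrt{(K^2+1)\lambda^2+2K\sqrt{K'}\lambda+K'-\frac{1}{K+K'}}}{\sqrt{10}}\quad\text{for all } n\ge2,\ 2\le k\le p,$$ $$|a_{n,k}|+|b_{n,k}|\le\frac{\sqrt{(K^2+1)\lambda^2+2K\sqrt{K'}\lambda+K'-\frac{1}{K+K'}}}{\sqrt{5}}\quad\text{for } n=1,\ 2\le k\le p.$$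
   Context: $\mathbb{D}=\{z\in\mathbb{C}:|z|<1\}$. For a continuously differentiable complex-valued $f$ put $\Lambda_f(z)=|f_z(z)|+|f_{\bar z}(z)|$, $\lambda_f(z)=\big||f_z(z)|-|f_{\bar z}(z)|\big|$, $J_f(z)=|f_z(z)|^2-|f_{\bar z}(z)|^2$. A $2p$-times continuously differentiable complex-valued $F$ is polyharmonic if $\Delta^pF=0$, where $\Delta=4\partial^2/\partial z\partial\bar z$. In $\mathbb{D}$ this is equivalent to $F(z)=\sum_{k=1}^p|z|^{2(k-1)}G_{p-k+1}(z)$ with all $G_{p-k+1}$ complex-valued harmonic in $\mathbb{D}$. In the series representation in the claim, for each $k$ the functions $\sum_{n\ge1}a_{n,k}z^n$ and $\sum_{n\ge1}b_{n,k}z^n$ are analytic in $\mathbb{D}$. A mapping $f$ is ACL in $\mathbb{D}$ if for every closed rectangle $R\subset\mathbb{D}$ with sides parallel to the axes, $f$ is absolutely continuous on almost every horizontal and almost every vertical line in $R$; $f\in ACL^2$ if moreover its partial derivatives are locally $L^2$ in $\mathbb{D}$. A sense-preserving continuous mapping $f:\mathbb{D}\to\mathbb{C}$ is $(K,K')$-elliptic ($K\ge1$, $K'\ge0$) if (1) $f$ is $ACL^2$ in $\mathbb{D}$ and $J_f\ne0$ a.e. in $\mathbb{D}$; and (2) $\Lambda_f^2\le KJ_f+K'$ a.e. in $\mathbb{D}$. (For a continuously differentiable $f$, which is automatically $ACL^2$, sense-preserving is taken to mean $J_f\ge0$, so that $J_f>0$ a.e.) $\arg$ denotes the principal argument, in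 $(-\pi,\pi]$. *)

(* Defs.v *)
From HB Require Import structures.
From mathcomp Require Import all_boot all_order all_algebra.
From mathcomp Require Import all_classical all_reals all_analysis.
From mathcomp Require Import complex ring.

Set Implicit Arguments.
Unset Strict Implicit.
Unset Printing Implicit Defensive.

Import Order.TTheory GRing.Theory Num.Theory.
Import numFieldNormedType.Exports.
Import ComplexField.Normc.

Local Open Scope classical_set_scope.
Local Open Scope complex_scope.
Local Open Scope ring_scope.

Definition disc (R : realType) : set R[i] := [set z | normc z < 1].

(* Real-differential calculus for functions R[i] -> R[i]. All functions are
   total; only their values on the open unit disc are ever constrained. *)

Definition partialx (R : realType) (f : R[i] -> R[i]) (z : R[i]) : R[i] :=
  derive1 (fun t : R => complex.Re (f (t +i* complex.Im z))) (complex.Re z) +i*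
  derive1 (fun t : R => complex.Im (f (t +i* complex.Im z))) (complex.Re z).

Definition partialy (R : realType) (f : R[i] -> R[i]) (z : R[i]) : R[i] :=
  derive1 (fun t : R => complex.Re (f (complex.Re z +i* t))) (complex.Im z) +i*
  derive1 (fun t : R => complex.Im (f (complex.Re z +i* t))) (complex.Im z).

Definition has_partials (R : realType) (f : R[i] -> R[i]) (z : R[i]) : Prop :=
  [/\ derivable (fun t : R => complex.Re (f (t +i* complex.Im z)))
        (complex.Re z) 1,
      derivable (fun t : R => complex.Im (f (t +i* complex.Im z)))
        (complex.Re z) 1,
      derivable (fun t : R => complex.Re (f (complex.Re z +i* t)))
        (complex.Im z) 1 &
      derivable (fun t : R => complex.Im (f (complex.Re z +i* t)))
        (complex.Im z) 1].

(* R[i]^o carries the topology of the norm of R[i]. *)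
Definition disc_continuous (R : realType) (f : R[i] -> R[i]) : Prop :=
  forall z, disc z -> {for z, continuous (f : R[i]^o -> R[i]^o)}.

Fixpoint disc_Ck (R : realType) (n : nat) (f : R[i] -> R[i]) : Prop :=
  disc_continuous f /\
  match n with
  | 0 => True
  | m.+1 => [/\ forall z, disc z -> has_partials f z,
                disc_Ck m (partialx f) &
                disc_Ck m (partialy f)]
  end.

Definition dz (R : realType) (f : R[i] -> R[i]) (z : R[i]) : R[i] :=
  (partialx f z - 'i%C * partialy f z) / 2%:R.

Definition dzbar (R : realType) (f : R[i] -> R[i]) (z : R[i]) : R[i] :=
  (partialx f z + 'i%C * partialy f z) / 2%:R.

Definition laplacian (R : realType) (f : R[i] -> R[i]) : R[i] -> R[i] :=
  fun z => 4%:R * dz (dzbar f) z.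

Definition Lambda_of (R : realType) (f : R[i] -> R[i]) (z : R[i]) : R :=
  normc (dz f z) + normc (dzbar f z).

Definition lambda_of (R : realType) (f : R[i] -> R[i]) (z : R[i]) : R :=
  `|normc (dz f z) - normc (dzbar f z)|.

Definition Jacobian_of (R : realType) (f : R[i] -> R[i]) (z : R[i]) : R :=
  normc (dz f z) ^+ 2 - normc (dzbar f z) ^+ 2.

Definition polyharmonic (R : realType) (p : nat) (f : R[i] -> R[i]) : Prop :=
  disc_Ck (2 * p) f /\
  forall z, disc z -> iter p (@laplacian R) f z = 0.

Definition absolutely_continuous (R : realType) (a b : R) (g : R -> R[i]) :
    Prop :=
  forall e : R, 0 < e -> exists2 d : R, 0 < d &
    forall (n : nat) (u v : nat -> R),
      (forall i, (i < n)%N -> [/\ a <= u i, u i <= v i & v i <= b]) ->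
      trivIset [set i | (i < n)%N] (fun i => [set t | u i < t < v i]) ->
      \sum_(0 <= i < n) (v i - u i) < d ->
      \sum_(0 <= i < n) normc (g (v i) - g (u i)) < e.

Definition ACL (R : realType) (f : R[i] -> R[i]) : Prop :=
  forall a b c d : R, a < b -> c < d ->
    (forall x y, a <= x <= b -> c <= y <= d -> disc (x +i* y)) ->
    {ae @lebesgue_measure R, forall y, c <= y <= d ->
       absolutely_continuous a b (fun x => f (x +i* y))} /\
    {ae @lebesgue_measure R, forall x, a <= x <= b ->
       absolutely_continuous c d (fun y => f (x +i* y))}.

Notation plane_measure R := (@lebesgue_measure R \x @lebesgue_measure R)%E.

Definition locally_L2 (R : realType) (g : R[i] -> R[i]) : Prop :=
  forall A : set (R * R), compact A ->
    (forall q, A q -> disc (q.1 +i* q.2)) ->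
    (plane_measure R).-integrable A
      (fun q => (normc (g (q.1 +i* q.2)) ^+ 2)%:E).

Definition ACL2 (R : realType) (f : R[i] -> R[i]) : Prop :=
  [/\ ACL f, locally_L2 (partialx f) & locally_L2 (partialy f)].

Definition ae_disc (R : realType) (P : R[i] -> Prop) : Prop :=
  {ae plane_measure R, forall q : R * R,
     disc (q.1 +i* q.2) -> P (q.1 +i* q.2)}.

(* (K, K')-ellipticity of a continuously differentiable mapping; the first two
   clauses render "sense-preserving continuous mapping" in that class. *)
Definition elliptic (R : realType) (K K' : R) (f : R[i] -> R[i]) : Prop :=
  [/\ disc_Ck 1 f,
      forall z, disc z -> 0 <= Jacobian_of f z,
      ACL2 f,
      ae_disc (fun z => Jacobian_of f z != 0) &
      ae_disc (fun z => Lambda_of f z ^+ 2 <= K * Jacobian_of f z + K')].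

Definition principal_arg (R : realType) (z : R[i]) : R :=
  let t := acos (complex.Re z / normc z) in
  if 0 <= complex.Im z then t else - t.

(* principal_arg z is the principal argument, in ]-pi, pi], of a nonzero z. *)
Lemma principal_argP (R : realType) (z : R[i]) : z != 0 ->
  - pi < principal_arg z <= pi /\
  z = (normc z)%:C * (cos (principal_arg z) +i* sin (principal_arg z)).
Proof.
case: z => x y z0; rewrite /principal_arg /=.
set r := Num.sqrt _.
have r0 : 0 < r.
  rewrite lt_neqAle sqrtr_ge0 andbT eq_sym.
  by apply: contra z0 => /eqP /(@eq0_normc _ (x +i* y)) ->.
have r2 : r ^+ 2 = x ^+ 2 + y ^+ 2 by rewrite sqr_sqrtr ?addr_ge0 ?sqr_ge0.
have xr : -1 <= x / r <= 1.
  have xr : `|x| <= r by rewrite -sqrtr_sqr ler_wsqrtr // lerDl sqr_ge0.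
  rewrite -ler_norml normrM normfV (gtr0_norm r0) ler_pdivrMr // mul1r.
  exact: xr.
have sE : Num.sqrt (1 - (x / r) ^+ 2) = `|y| / r.
  have -> : 1 - (x / r) ^+ 2 = (y / r) ^+ 2.
    rewrite !expr_div_n -[1](@divff _ (r ^+ 2)) ?expf_neq0 ?gt_eqF //.
    by rewrite -mulrBl {1}r2 addrAC subrr add0r.
  by rewrite sqrtr_sqr normrM normfV (gtr0_norm r0).
have rn0 : r != 0 by rewrite gt_eqF.
have mE (c s : R) : r%:C * (c +i* s) = (r * c) +i* (r * s) by simpc.
case: ifPn => y0.
  split; first by rewrite acos_lepi // (lt_le_trans _ (acos_ge0 xr)) //
                          oppr_lt0 pi_gt0.
  rewrite mE acosK // sin_acos // sE ger0_norm //.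
  by congr (_ +i* _); field.
have yn : y < 0 by rewrite ltNge.
split.
  rewrite ltrN2 (le_trans _ (pi_ge0 R)) ?oppr_le0 ?acos_ge0 // andbT.
  rewrite acos_ltpi // lt_neqAle; case/andP: xr => -> ->; rewrite !andbT.
  apply/eqP => xE; move: r2; have -> : x = - r.
    by rewrite -[x](divfK rn0) -xE mulN1r.
  rewrite sqrrN => /eqP; rewrite -subr_eq0 opprD addNKr.
  by rewrite oppr_eq0 sqrf_eq0 lt_eqF.
rewrite mE cosN sinN acosK // sin_acos // sE ltr0_norm //.
by congr (_ +i* _); field.
Qed.

Definition power_sum (R : realType) (c : nat -> R[i]) (z : R[i]) (N : nat) :
    R[i]^o :=
  \sum_(1 <= n < N) c n * z ^+ n.

(* Main.v *)
(* Write P = z F_z + conj z F_zbar and Q = z F_z - conj z F_zbar. The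
   parallelogram identity and Lambda <= K lambda + sqrt K', a consequence of
   ellipticity, bound |P|^2 + |Q|^2 = |z|^2 (Lambda^2 + lambda^2) by
   S = (K lam + sqrt K')^2 + lam^2. On |z| = r both P and Q are trigonometric
   series with n-th coefficients sum_k (n + 2(k-1)) r^(n+2(k-1)) a_{n,k} and
   sum_k n r^(n+2(k-1)) a_{n,k}, and the same with b. Parseval, then dropping
   the cross terms (nonnegative by the argument condition) and letting r tend
   to 1, gives
     sum_{n,k} (n^2 + (n + 2(k-1))^2) (|a_{n,k}|^2 + |b_{n,k}|^2) <= S.
   The (1,1) term is at least 2 J_F(0) = 2 >= 1/(K+K'), and every other term is
   bounded by what remains. Parseval is used in its discrete form, averaging
   uniform approximations of P and Q over roots of unity, so that no
   integration is needed. *)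

Require Import Defs.
From HB Require Import structures.
From mathcomp Require Import all_boot all_order all_algebra.
From mathcomp Require Import all_classical all_reals all_analysis.
From mathcomp Require Import complex.
From mathcomp Require Import zify ring lra.

Set Implicit Arguments.
Unset Strict Implicit.
Unset Printing Implicit Defensive.

Import Order.TTheory GRing.Theory Num.Theory.
Import numFieldNormedType.Exports.
Import ComplexField.Normc.

Local Open Scope classical_set_scope.
Local Open Scope complex_scope.
Local Open Scope ring_scope.

(** * Moduli and convergence of complex sequences *)

Lemma norm_normc (R : realType) (z : R[i]) : `|z| = (normc z)%:C.
Proof. by []. Qed.

Lemma normc_ge0 (R : realType) (z : R[i]) : 0 <= normc z.
Proof. by rewrite -lecR -norm_normc normr_ge0. Qed.

Lemma normc_conj (R : realType) (z : R[i]) : normc (conjc z) = normc z.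
Proof. by apply: complexI; rewrite -!norm_normc normcJ. Qed.

Lemma normcX (R : realType) (z : R[i]) n : normc (z ^+ n) = normc z ^+ n.
Proof. by apply: complexI; rewrite -norm_normc normrX rmorphXn. Qed.

Lemma normcR (R : realType) (x : R) : normc x%:C = `|x|.
Proof. by rewrite /= expr0n /= addr0 sqrtr_sqr. Qed.

Lemma normc_nat (R : realType) n : normc (n%:R : R[i]) = n%:R.
Proof. by rewrite -(rmorph_nat (real_complex R)) normcR ger0_norm. Qed.

Lemma normcB (R : realType) (x y : R[i]) : normc (x - y) = normc (y - x).
Proof. by rewrite -normcN opprB. Qed.

Lemma normc_sum (R : realType) I (r : seq I) (P : pred I) (E : I -> R[i]) :
  normc (\sum_(i <- r | P i) E i) <= \sum_(i <- r | P i) normc (E i).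
Proof.
elim/big_rec2: _ => [|i y x _ h]; first by rewrite normc0.
by apply: le_trans (le_normcD _ _) _; rewrite lerD2l.
Qed.

Lemma sqr_normcE (R : realType) (z : R[i]) :
  (normc z ^+ 2)%:C = z * conjc z.
Proof. by rewrite rmorphXn /= -sqr_normc norm_normc. Qed.

Lemma ler_Re_normc (R : realType) (z : R[i]) : `|complex.Re z| <= normc z.
Proof. by rewrite -lecR -norm_normc normc_ge_Re. Qed.
Lemma ler_Im_normc (R : realType) (z : R[i]) : `|complex.Im z| <= normc z.
Proof.
case: z => x y /=; rewrite -sqrtr_sqr ler_wsqrtr // lerDr; exact: sqr_ge0.
Qed.

Lemma normc_le_ReIm (R : realType) (z : R[i]) :
  normc z <= `|complex.Re z| + `|complex.Im z|.
Proof.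
rewrite {1}[z]complexE; apply: le_trans (le_normcD _ _) _.
by rewrite normcM !normcR /= expr0n expr1n add0r sqrtr1 mul1r.
Qed.

Lemma cvgcP (R : realType) (u : nat -> R[i]^o) (l : R[i]) :
  u @ \oo --> (l : R[i]^o) <->
  forall e : R, 0 < e ->
    exists N, forall n, (N <= n)%N -> normc (u n - l) < e.
Proof.
split=> [/cvgrPdist_lt h e e0|h].
  have e0C : (0 : R[i]) < e%:C by rewrite ltcR.
  have [N _ hN] := h _ e0C; exists N => n /hN /=.
  by rewrite norm_normc ltcR normcB.
apply/cvgrPdist_lt => e e0.
have eE : e = (complex.Re e)%:C by rewrite RRe_real // gtr0_real.
have [|N hN] := h (complex.Re e); first by rewrite -ltcR -eE.
by exists N => // n /hN; rewrite eE norm_normc ltcR normcB.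
Qed.

Lemma limc_eq (R : realType) (u : nat -> R[i]^o) (l : R[i]) :
  u @ \oo --> (l : R[i]^o) -> limn u = l.
Proof. exact: cvg_lim. Qed.

Lemma cvgc_le (R : realType) (u : nat -> R[i]^o) (l : R[i]) (B : R) N :
  u @ \oo --> (l : R[i]^o) ->
  (forall n, (N <= n)%N -> normc (u n) <= B) -> normc l <= B.
Proof.
move=> /cvgcP ul uB; apply/ler_addgt0Pr => e e0.
have [m hm] := ul e e0.
have /hm h := leq_maxr N m; have /uB h' := leq_maxl N m.
rewrite -[l](subrK (u (maxn N m))) addrC.
apply: le_trans (le_normcD _ _) _; apply: lerD => //.
by rewrite normcB ltW.
Qed.

Lemma geometric_tail (R : realType) (s : R) m n : 0 <= s -> s < 1 ->
  \sum_(m <= i < n) s ^+ i <= s ^+ m / (1 - s).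
Proof.
move=> s0 s1; have d0 : 0 < 1 - s by rewrite subr_gt0.
rewrite ler_pdivlMr //.
have [nm|mn] := leqP n m.
  by rewrite big_geq // mul0r exprn_ge0.
have -> : (\sum_(m <= i < n) s ^+ i) * (1 - s) = s ^+ m - s ^+ n.
  rewrite -[RHS]opprB -(telescope_sumr (fun i => s ^+ i)) 1?ltnW //.
  rewrite -sumrN mulr_suml.
  by apply: eq_bigr => i _; rewrite exprSr mulrBr mulr1 opprB.
by rewrite lerBlDr lerDl exprn_ge0.
Qed.

(** Real and imaginary parts converge absolutely, so completeness of the reals suffices; the tail
    estimate passes to the limit from finite blocks. *)
Lemma cvgc_geometric (R : realType) (u : nat -> R[i]) (C s : R) :
  0 <= s -> s < 1 -> (forall n, (0 < n)%N -> normc (u n) <= C * s ^+ n) ->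
  exists l : R[i],
    ((fun N => \sum_(1 <= n < N) u n) : nat -> R[i]^o) @ \oo --> (l : R[i]^o)
  /\ forall N, (0 < N)%N ->
       normc (l - \sum_(1 <= n < N) u n) <= C * (s ^+ N / (1 - s)).
Proof.
move=> s0 s1 uC.
have C0 : 0 <= C * s by apply: le_trans (normc_ge0 _) (uC 1%N _).
have tail m n : (0 < m)%N ->
    normc (\sum_(m <= i < n) u i) <= C * (s ^+ m / (1 - s)).
  move=> m0; apply: le_trans (normc_sum _ _ _) _.
  (* A negative [C] forces [s = 0], because [C * s] bounds a modulus; every term then vanishes. *)
  have [C1|C1] := leP 0 C; last first.
    have s00 : s = 0.
      by apply/eqP; rewrite eq_le s0 andbT; rewrite nmulr_rge0 in C0.
    rewrite big_nat_cond big1 ?s00 ?expr0n ?(gtn_eqF m0) ?mul0r ?mulr0 //.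
    move=> i /andP[/andP[mi _] _]; have i0 := leq_trans m0 mi.
    apply/eqP; rewrite eq_le normc_ge0 andbT.
    by apply: le_trans (uC _ i0) _; rewrite s00 expr0n gtn_eqF // mulr0.
  apply: (@le_trans _ _ (\sum_(m <= i < n) C * s ^+ i)).
    by apply: ler_sum_nat => i /andP[mi _]; apply: uC; apply: leq_trans mi.
  by rewrite -mulr_sumr ler_wpM2l // geometric_tail.
have part (f : R[i] -> R) : (forall z, `|f z| <= normc z) ->
    cvgn (series (fun n => f (u n.+1))).
  move=> fn; apply: normed_cvg.
  apply: (@series_le_cvg _ _ (fun n => C * s * s ^+ n)) => n /=.
  - exact: normr_ge0.
  - by rewrite mulr_ge0 // exprn_ge0.
  - by apply: le_trans (fn _) _; rewrite -mulrA -exprS uC.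
  - apply: is_cvg_geometric_series.
    by rewrite ger0_norm.
have [x xl] := proj1 (cvg_ex _) (part (@complex.Re R) (@ler_Re_normc R)).
have [y yl] := proj1 (cvg_ex _) (part (@complex.Im R) (@ler_Im_normc R)).
have cl : ((fun N => \sum_(1 <= n < N) u n) : nat -> R[i]^o) @ \oo -->
    ((x +i* y) : R[i]^o).
  apply/cvgcP => e e0.
  have e2 : 0 < e / 2 by rewrite divr_gt0.
  move/cvgrPdist_lt : xl => /(_ _ e2)[N1 _ h1].
  move/cvgrPdist_lt : yl => /(_ _ e2)[N2 _ h2].
  exists (maxn N1 N2).+1 => [[//|n]]; rewrite ltnS geq_max => /andP[n1 n2].
  have /= {}h1 := h1 _ n1; have /= {}h2 := h2 _ n2.
  apply: le_lt_trans (normc_le_ReIm _) _.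
  rewrite [ltRHS](splitr e); apply: ltrD.
    rewrite distrC in h1; apply: le_lt_trans h1.
    by rewrite raddfB raddf_sum /= big_add1 /=.
  rewrite distrC in h2; apply: le_lt_trans h2.
  by rewrite raddfB raddf_sum /= big_add1 /=.
exists (x +i* y); split=> // N N0.
have cl2 : ((fun M => \sum_(1 <= n < M) u n - \sum_(1 <= n < N) u n)
  : nat -> R[i]^o) @ \oo --> ((x +i* y - \sum_(1 <= n < N) u n) : R[i]^o).
  apply/cvgcP => e e0; have [M hM] := proj1 (cvgcP _ _) cl e e0.
  by exists M => n /hM; rewrite opprB addrA subrK.
apply: (cvgc_le (N := N) cl2) => n Nn.
by rewrite (big_cat_nat N0 Nn) /= addrAC subrr add0r tail.
Qed.

(** * Power series and Wirtinger derivatives *)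

(** Each radius [r < 1] has its own geometric majorant. This form survives multiplication of the
    n-th coefficient by n and yields uniform convergence directly. Index 0 is left out because the
    series start at 1. *)
Definition majorized (R : realType) (c : nat -> R[i]) : Prop :=
  forall r : R, 0 < r -> r < 1 -> exists C s : R,
    [/\ 0 <= s, s < 1 &
        forall n, (0 < n)%N -> normc (c n) * r ^+ n <= C * s ^+ n].

Definition psum (R : realType) (c : nat -> R[i]) (z : R[i]) : R[i] :=
  limn (power_sum c z).

(** The Euler operator z d/dz acting on the coefficients of a power series. *)
Definition euler_coef (R : realType) (c : nat -> R[i]) (n : nat) : R[i] :=
  n%:R * c n.

(** Convergence at a radius [t] between [r] and 1 bounds the terms there, and the ratio [r / t] then
    gives geometric decay. *)
Lemma cvg_majorized (R : realType) (c : nat -> R[i]) :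
  (forall z, disc z -> cvgn (power_sum c z)) -> majorized c.
Proof.
move=> hc r r0 r1.
pose t := (1 + r) / 2; have t1 : t < 1 by rewrite /t; lra.
have t0 : 0 < t by rewrite /t; lra.
have rt : r < t by rewrite /t; lra.
have td : disc t%:C by rewrite /disc /mkset normcR gtr0_norm.
have [l /cvgcP hl] := proj1 (cvg_ex _) (hc _ td).
have [N hN] := hl 1 ltr01.
(* Past [N] two neighbouring partial sums both lie within 1 of the limit, so a term is at most 2;
   the finite sum covers the earlier terms. *)
pose B := 2 + \sum_(0 <= i < N) normc (c i) * t ^+ i.
have S0 m : 0 <= \sum_(0 <= i < m) normc (c i) * t ^+ i.
  by apply: sumr_ge0 => i _; rewrite mulr_ge0 ?normc_ge0 // exprn_ge0 // ltW.
have hB n : (0 < n)%N -> normc (c n) * t ^+ n <= B.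
  move=> n0; have [nN|Nn] := ltnP n N.
    rewrite /B (bigD1_seq n) ?mem_index_iota ?iota_uniq //= addrCA lerDl.
    rewrite addr_ge0 // sumr_ge0 // => i _.
    by rewrite mulr_ge0 ?normc_ge0 // exprn_ge0 // ltW.
  apply: (@le_trans _ _ 2); last by rewrite /B lerDl.
  have h1 := hN _ Nn; have h2 := hN _ (leqW Nn).
  have -> : normc (c n) * t ^+ n =
      normc ((power_sum c t%:C n.+1 - l) + (l - power_sum c t%:C n)).
    rewrite addrA subrK /power_sum big_nat_recr //= addrAC subrr add0r.
    by rewrite normcM normcX normcR gtr0_norm.
  apply: le_trans (le_normcD _ _) _.
  by rewrite -[2]/(1 + 1) lerD // ltW // normcB.
exists B, (r / t); split.
- by rewrite divr_ge0 // ltW.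
- by rewrite ltr_pdivrMr // mul1r.
move=> n n0; rewrite expr_div_n mulrA ler_pdivlMr ?exprn_gt0 //.
by rewrite mulrAC ler_wpM2r ?hB // exprn_ge0 // ltW.
Qed.

(** For t = (1 + s) / 2 the difference t^2 - s is ((1 - s) / 2)^2, so s^n <= t^n t^n. One factor t^n
    absorbs n, since n t^n is at most the sum of t^i over i < n, hence at most 1 / (1 - t). *)
Lemma natr_geometric (R : realType) (s : R) : 0 <= s -> s < 1 ->
  exists D t : R, [/\ 0 <= D, 0 <= t, t < 1 &
    forall n, n%:R * s ^+ n <= D * t ^+ n].
Proof.
move=> s0 s1; pose t := (1 + s) / 2.
have t1 : t < 1 by rewrite /t; lra.
have t0 : 0 <= t by rewrite /t; lra.
exists (1 - t)^-1, t; split=> //; first by rewrite invr_ge0 subr_ge0 ltW.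
move=> n; have st : s <= t * t by rewrite /t; nra.
apply: (@le_trans _ _ (n%:R * (t * t) ^+ n)).
  by rewrite ler_wpM2l // lerXn2r // nnegrE mulr_ge0.
rewrite exprMn mulrA ler_wpM2r ?exprn_ge0 //.
have := @geometric_tail R t 0 n t0 t1; rewrite expr0 div1r.
apply: le_trans; rewrite mulr_natl -[X in _ *+ X]subn0 -sumr_const_nat.
apply: ler_sum_nat => i /andP[_ ni].
by rewrite ler_wiXn2l //; [exact: ltW | exact: ltnW].
Qed.

Lemma majorized_euler (R : realType) (c : nat -> R[i]) :
  majorized c -> majorized (euler_coef c).
Proof.
move=> hc r r0 r1; have [C [s [s0 s1 hs]]] := hc r r0 r1.
have [D [t [D0 t0 t1 ht]]] := natr_geometric s0 s1.
exists (`|C| * D), t; split=> // n n0.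
rewrite normcM normc_nat -mulrA.
apply: (@le_trans _ _ (n%:R * (`|C| * s ^+ n))).
  rewrite ler_wpM2l //; apply: le_trans (hs n n0) _.
  by rewrite ler_wpM2r ?exprn_ge0 ?ler_norm.
by rewrite mulrCA -mulrA ler_wpM2l.
Qed.

(** Weierstrass M-test: [C] and [s] are fixed before [z], so the tail estimate is uniform on the
    closed disc of radius [r]. *)
Lemma psum_uniform (R : realType) (c : nat -> R[i]) (r : R) :
  majorized c -> 0 < r -> r < 1 -> exists C s : R,
  [/\ 0 <= s, s < 1 & forall z, normc z <= r ->
    (power_sum c z @ \oo --> (psum c z : R[i]^o)) /\
    forall N, (0 < N)%N ->
      normc (psum c z - power_sum c z N) <= C * s ^+ N].
Proof.
move=> hc r0 r1; have [C [s [s0 s1 hs]]] := hc r r0 r1.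
exists (C / (1 - s)), s; split=> // z zr.
have hz n : (0 < n)%N -> normc (c n * z ^+ n) <= C * s ^+ n.
  move=> n0; apply: le_trans (hs n n0).
  by rewrite normcM normcX ler_wpM2l ?normc_ge0 // lerXn2r ?nnegrE
             ?normc_ge0 // ltW.
have [l [lim tail]] := cvgc_geometric s0 s1 hz.
have <- : l = psum c z by rewrite /psum (limc_eq lim).
split=> // N N0; apply: le_trans (tail N N0) _.
by rewrite mulrAC -mulrA.
Qed.

Lemma psum_cvg (R : realType) (c : nat -> R[i]) (z : R[i]) :
  majorized c -> disc z -> power_sum c z @ \oo --> (psum c z : R[i]^o).
Proof.
rewrite /disc /mkset => hc z1; pose r := (1 + normc z) / 2.
have z0 := normc_ge0 z.
have [||C [s [_ _ h]]] := @psum_uniform R c r hc; rewrite /r; try lra.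
by apply: (proj1 (h z _)); rewrite /r; lra.
Qed.

(* First-order expansion at z with a quadratic remainder; al and be are the
   Wirtinger derivatives. *)
Definition qdiff (R : realType) (f : R[i] -> R[i]) (z al be : R[i]) : Prop :=
  exists C d : R, [/\ 0 <= C, 0 < d & forall w, normc (w - z) < d ->
    normc (f w - f z - (al * (w - z) + be * conjc (w - z)))
      <= C * normc (w - z) ^+ 2].

(** The factor r^2 on the left avoids an exponent n - 2 on the right. In the induction the remainder
    is multiplied by w and gains n z^(n-1) (w - z)^2, and n^2 + n <= (n + 1)^2. *)
Lemma expr_taylor (R : realType) (z w : R[i]) (r : R) n :
  0 <= r -> normc z <= r -> normc w <= r ->
  normc (w ^+ n - z ^+ n - n%:R * z ^+ n.-1 * (w - z)) * r ^+ 2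
    <= n%:R ^+ 2 * r ^+ n * normc (w - z) ^+ 2.
Proof.
move=> r0 zr wr; elim: n => [|n IH].
  by rewrite !expr0 subrr !mul0r subr0 normc0 mul0r expr0n /= !mul0r.
have -> : w ^+ n.+1 - z ^+ n.+1 - n.+1%:R * z ^+ n.+1.-1 * (w - z) =
   w * (w ^+ n - z ^+ n - n%:R * z ^+ n.-1 * (w - z)) +
   n%:R * z ^+ n.-1 * (w - z) ^+ 2.
  by case: n {IH} => [|n]; rewrite /= !exprS -?natr1 ?expr0; ring.
set E := w ^+ n - z ^+ n - _ in IH *.
have h0 := normc_ge0 (w - z); set h := normc (w - z) in IH h0 *.
apply: (@le_trans _ _ ((r * normc E + n%:R * r ^+ n.-1 * h ^+ 2) * r ^+ 2)).
  rewrite ler_wpM2r ?exprn_ge0 //; apply: le_trans (le_normcD _ _) _.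
  rewrite !normcM !normcX normc_nat; apply: lerD.
    by rewrite ler_wpM2r ?normc_ge0.
  rewrite ler_wpM2r ?mulr_ge0 ?normc_ge0 // ler_wpM2l // lerXn2r ?nnegrE //.
  exact: normc_ge0.
apply: (@le_trans _ _ (r * (n%:R ^+ 2 * r ^+ n * h ^+ 2) +
                       n%:R * r ^+ n.+1 * h ^+ 2)).
  rewrite mulrDl -mulrA lerD ?ler_wpM2l //.
  case: n {IH E} => [|n]; first by rewrite !mul0r.
  by rewrite /= [X in _ <= X](_ : _ = n.+1%:R * r ^+ n * h ^+ 2 * r ^+ 2) //
             !exprS; ring.
have -> : r * (n%:R ^+ 2 * r ^+ n * h ^+ 2) + n%:R * r ^+ n.+1 * h ^+ 2 =
  (n%:R ^+ 2 + n%:R) * r ^+ n.+1 * h ^+ 2 by rewrite [r ^+ n.+1]exprS; ring.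
rewrite !ler_wpM2r ?exprn_ge0 // -natr1.
by have := ler0n R n; nra.
Qed.

Lemma normc_affineB (R : realType) (a b c a' b' c' h : R[i]) :
  normc (a - b - c * h - (a' - b' - c' * h)) <=
    normc (a - a') + normc (b - b') + normc (c - c') * normc h.
Proof.
have -> : a - b - c * h - (a' - b' - c' * h) =
  (a - a') - (b - b') - (c - c') * h by ring.
apply: le_trans (le_normcD _ _) _; rewrite normcN normcM lerD2r.
by apply: le_trans (le_normcD _ _) _; rewrite normcN.
Qed.

(* The derivative is kept implicit so that no division by z is visible at 0. *)
Lemma psum_qdiff (R : realType) (c : nat -> R[i]) (z : R[i]) :
  majorized c -> disc z -> exists dc : R[i],
  [/\ qdiff (psum c) z dc 0, z * dc = psum (euler_coef c) z &
      z = 0 -> dc = c 1%N].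
Proof.
move=> hc zd; have hc1 := majorized_euler hc.
have z1 : normc z < 1 := zd; have z0 := normc_ge0 z.
pose S N : R[i] := \sum_(1 <= n < N) c n * (n%:R * z ^+ n.-1).
have [dc [Sdc zdc dc0]] : exists dc : R[i],
    [/\ (S : nat -> R[i]^o) @ \oo --> (dc : R[i]^o),
        z * dc = psum (euler_coef c) z & z = 0 -> dc = c 1%N].
  (* At 0 the derivative series reduces to its first term; elsewhere it is the Euler series divided
     by z. *)
  have [zE|zN0] := eqVneq z 0.
    exists (c 1%N); split=> //; last first.
      rewrite zE mul0r /psum; apply/esym/limc_eq; apply/cvgcP => e e0.
      exists 0%N => n _; rewrite subr0 /power_sum big_nat_cond big1 ?normc0 //.
      by move=> i /andP[/andP[i0 _] _]; rewrite expr0n gtn_eqF // mulr0.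
    apply/cvgcP => e e0; exists 2%N => n n2.
    rewrite /S big_ltn // big_nat_cond big1; last first.
      move=> i /andP[/andP[i2 _] _]; rewrite zE expr0n.
      by case: i i2 => [|[|i]] //= _; rewrite !mulr0.
    by rewrite expr0 !mulr1 addr0 subrr normc0.
  exists (psum (euler_coef c) z / z); split.
  - have /cvgcP h := psum_cvg hc1 zd.
    apply/cvgcP => e e0; have nz0 : 0 < normc z.
      by rewrite lt_neqAle z0 eq_sym andbT; apply: contra zN0 => /eqP/eq0_normc->.
    have [N hN] := h (e * normc z) (mulr_gt0 e0 nz0).
    exists N => n /hN; rewrite -ltr_pdivrMr // -normcV.
    rewrite -normcM mulrBl; congr (normc (_ - _) < _).
    rewrite /S /power_sum mulr_suml; apply: eq_big_nat => -[//|i] _.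
    by rewrite /euler_coef /= exprSr; field.
  - by rewrite mulrC divfK.
  - by move/eqP; rewrite (negPf zN0).
exists dc; split=> //.
pose r := (1 + normc z) / 2.
have r0 : 0 < r by rewrite /r; lra.
have r1 : r < 1 by rewrite /r; lra.
(* Applying the Euler operator twice supplies the n^2 that appears in [expr_taylor]. *)
have [C [s [s0 s1 hs]]] := majorized_euler hc1 r0 r1.
pose B := `|C| / (1 - s) / r ^+ 2.
have B0 : 0 <= B.
  by rewrite !divr_ge0 // ?subr_ge0 ?exprn_ge0 // ltW.
exists B, (r - normc z); split=> //; first by rewrite /r; lra.
move=> w wz; have wr : normc w <= r.
  rewrite -[w](subrK z); apply: le_trans (le_normcD _ _) _.
  by move: wz; rewrite /r; lra.
have wd : disc w by apply: le_lt_trans wr r1.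
have zr : normc z <= r by rewrite /r; lra.
have /cvgcP hz := psum_cvg hc zd; have /cvgcP hw := psum_cvg hc wd.
have /cvgcP hS := Sdc.
pose h := w - z.
have lim : ((fun N => power_sum c w N - power_sum c z N - S N * h)
    : nat -> R[i]^o) @ \oo --> ((psum c w - psum c z - dc * h) : R[i]^o).
  have h1 : 0 < normc h + 1 by have := normc_ge0 h; lra.
  apply/cvgcP => e e0; have e3 : 0 < e / 3 by rewrite divr_gt0.
  have [N1 H1] := hw _ e3; have [N2 H2] := hz _ e3.
  have [N3 H3] := hS _ (divr_gt0 e3 h1).
  exists (maxn N1 (maxn N2 N3)) => n; rewrite !geq_max => /and3P[n1 n2 n3].
  apply: le_lt_trans (normc_affineB _ _ _ _ _ _ _) _.
  have -> : e = e / 3 + e / 3 + e / 3 by lra.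
  apply: ltr_leD; first by apply: ltrD; [exact: H1 | exact: H2].
  have hh : normc h <= normc h + 1 by rewrite lerDl.
  apply: le_trans (ler_wpM2l (normc_ge0 _) hh) _.
  by rewrite -ler_pdivlMr // ltW // H3.
have -> : psum c w - psum c z - (dc * (w - z) + 0 * conjc (w - z)) =
  psum c w - psum c z - dc * h by rewrite mul0r addr0.
(* The quadratic bound holds for all partial sums with one constant, hence for the limit. *)
apply: (cvgc_le (N := 1) lim) => N N1.
have -> : power_sum c w N - power_sum c z N - S N * h =
   \sum_(1 <= n < N) c n * (w ^+ n - z ^+ n - n%:R * z ^+ n.-1 * h).
  rewrite /power_sum /S mulr_suml -!sumrB; apply: eq_bigr => i _.
  by ring.
apply: le_trans (normc_sum _ _ _) _.
have r20 : 0 < r ^+ 2 by rewrite exprn_gt0.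
rewrite [leRHS]mulrAC ler_pdivlMr // mulr_suml.
apply: (@le_trans _ _ (\sum_(1 <= n < N) `|C| * normc h ^+ 2 * s ^+ n)).
  apply: ler_sum_nat => n /andP[n0 _].
  rewrite normcM -[leLHS]mulrA; apply: (@le_trans _ _
    (normc (c n) * (n%:R ^+ 2 * r ^+ n * normc h ^+ 2))).
    by rewrite ler_wpM2l ?normc_ge0 // expr_taylor // ltW.
  have := hs n n0; rewrite /euler_coef !normcM !normc_nat => hn.
  have -> : normc (c n) * (n%:R ^+ 2 * r ^+ n * normc h ^+ 2) =
    n%:R * (n%:R * normc (c n)) * r ^+ n * normc h ^+ 2 by ring.
  rewrite [leRHS]mulrAC ler_wpM2r ?exprn_ge0 ?normc_ge0 //.
  by apply: le_trans hn _; rewrite ler_wpM2r ?exprn_ge0 ?ler_norm.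
rewrite -mulr_sumr [leRHS]mulrAC ler_wpM2l ?mulr_ge0 ?exprn_ge0 ?normc_ge0 //.
apply: le_trans (geometric_tail _ _ s0 s1) _.
by rewrite ler_piMl ?invr_ge0 ?subr_ge0 ?(ltW s1) // expr1 ltW.
Qed.

(** * Calculus rules for first-order expansions *)

Lemma qdiff_ext (R : realType) (f g : R[i] -> R[i]) (z al be : R[i]) :
  disc z -> (forall w, disc w -> f w = g w) -> qdiff g z al be ->
  qdiff f z al be.
Proof.
move=> zd fg [C [d [C0 d0 h]]].
exists C, (Num.min d (1 - normc z)); split=> //.
  by rewrite lt_min d0 subr_gt0.
move=> w; rewrite lt_min => /andP[wd wz]; rewrite !fg //; first exact: h.
rewrite /disc /mkset -[w](subrK z); apply: le_lt_trans (le_normcD _ _) _.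
by rewrite -ltrBrDr.
Qed.

Lemma qdiff_cst (R : realType) (c z : R[i]) : qdiff (fun=> c) z 0 0.
Proof.
exists 0, 1; split=> // w _.
by rewrite subrr !mul0r addr0 subrr normc0.
Qed.

Lemma qdiff_id (R : realType) (z : R[i]) : qdiff id z 1 0.
Proof.
exists 0, 1; split=> // w _.
by rewrite mul1r !mul0r addr0 subrr normc0.
Qed.

Lemma qdiff_conj (R : realType) (f : R[i] -> R[i]) (z al be : R[i]) :
  qdiff f z al be -> qdiff (fun w => conjc (f w)) z (conjc be) (conjc al).
Proof.
move=> [C [d [C0 d0 h]]]; exists C, d; split=> // w /h.
rewrite -normc_conj; congr (normc _ <= _).
by rewrite !(rmorphB, rmorphD, rmorphM) /= !conjcK; congr (_ - _); exact: addrC.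
Qed.

Lemma qdiff_add (R : realType) (f g : R[i] -> R[i]) (z al be al' be' : R[i]) :
  qdiff f z al be -> qdiff g z al' be' ->
  qdiff (fun w => f w + g w) z (al + al') (be + be').
Proof.
move=> [C [d [C0 d0 h]]] [C' [d' [C'0 d'0 h']]].
exists (C + C'), (Num.min d d'); split.
- exact: addr_ge0.
- by rewrite lt_min d0.
move=> w; rewrite lt_min => /andP[/h {}h /h' {}h'].
have -> : f w + g w - (f z + g z) -
    ((al + al') * (w - z) + (be + be') * conjc (w - z)) =
  (f w - f z - (al * (w - z) + be * conjc (w - z))) +
  (g w - g z - (al' * (w - z) + be' * conjc (w - z))) by ring.
by rewrite mulrDl; apply: le_trans (lerD h h'); exact: le_normcD.
Qed.

Lemma qdiff_sum (R : realType) (f al be : nat -> R[i] -> R[i]) (z : R[i]) m n :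
  (forall k, (m <= k < n)%N -> qdiff (f k) z (al k z) (be k z)) ->
  qdiff (fun w => \sum_(m <= k < n) f k w) z
        (\sum_(m <= k < n) al k z) (\sum_(m <= k < n) be k z).
Proof.
elim: n => [|n IH] h.
  by rewrite !big_geq // (_ : (fun _ => _) = fun=> 0);
     [exact: qdiff_cst | apply/funext => w; rewrite big_geq].
have [nm|mn] := ltnP n m.
  by rewrite !big_geq // (_ : (fun _ => _) = fun=> 0);
     [exact: qdiff_cst | apply/funext => w; rewrite big_geq].
rewrite !big_nat_recr //= (_ : (fun _ => _) =
    fun w => \sum_(m <= k < n) f k w + f n w); last first.
  by apply/funext => w; rewrite big_nat_recr.
apply: qdiff_add; last by apply: h; rewrite mn leqnn.
by apply: IH => k /andP[mk kn]; apply: h; rewrite mk ltnW.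
Qed.

(** Supplies the product rule with a bound on the second factor near [z] and a linear bound on its
    increment. *)
Lemma qdiff_lipschitz (R : realType) (f : R[i] -> R[i]) (z al be : R[i]) :
  qdiff f z al be -> exists L d : R, [/\ 0 <= L, 0 < d & forall w,
    normc (w - z) < d -> normc (f w - f z) <= L * normc (w - z)].
Proof.
move=> [C [d [C0 d0 h]]].
exists (C + (normc al + normc be)), (Num.min d 1); split.
- by rewrite !addr_ge0 ?normc_ge0.
- by rewrite lt_min d0 ltr01.
move=> w; rewrite lt_min => /andP[/h {}h /ltW w1].
have w0 := normc_ge0 (w - z).
rewrite -[f w - f z](subrK (al * (w - z) + be * conjc (w - z))).
apply: le_trans (le_normcD _ _) _; rewrite mulrDl; apply: lerD.
  apply: le_trans h _; rewrite ler_wpM2l // expr2.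
  by rewrite ler_piMr.
by apply: le_trans (le_normcD _ _) _; rewrite !normcM normc_conj mulrDl.
Qed.

Lemma qdiff_mul (R : realType) (f g : R[i] -> R[i]) (z al be al' be' : R[i]) :
  qdiff f z al be -> qdiff g z al' be' ->
  qdiff (fun w => f w * g w) z (al * g z + f z * al') (be * g z + f z * be').
Proof.
move=> hf hg; have [L [e [L0 e0 hL]]] := qdiff_lipschitz hg.
move: hf hg => [C [d [C0 d0 h]]] [C' [d' [C'0 d'0 h']]].
pose A := normc al + normc be.
have A0 : 0 <= A by rewrite addr_ge0 ?normc_ge0.
exists (normc (f z) * C' + C * (normc (g z) + L) + A * L).
exists (Num.min (Num.min d d') (Num.min e 1)); split.
- by rewrite !(addr_ge0, mulr_ge0) ?normc_ge0.
- by rewrite !lt_min d0 d'0 e0 ltr01.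
move=> w; rewrite !lt_min => /andP[/andP[/h {}h /h' {}h'] /andP[/hL {}hL w1]].
have t0 := normc_ge0 (w - z).
(* The error splits into the remainder of [g] times [f z], the remainder of [f] times [g w], and the
   linear part of [f] times the increment of [g]; each is quadratic in the distance. *)
have -> : f w * g w - f z * g z - ((al * g z + f z * al') * (w - z) +
    (be * g z + f z * be') * conjc (w - z)) =
  f z * (g w - g z - (al' * (w - z) + be' * conjc (w - z))) +
  (f w - f z - (al * (w - z) + be * conjc (w - z))) * g w +
  (al * (w - z) + be * conjc (w - z)) * (g w - g z) by ring.
have gw : normc (g w) <= normc (g z) + L.
  rewrite -[g w](subrK (g z)) addrC; apply: le_trans (le_normcD _ _) _.
  by rewrite lerD2l (le_trans hL) // ler_piMr // ltW.
have lw : normc (al * (w - z) + be * conjc (w - z)) <= A * normc (w - z).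
  by apply: le_trans (le_normcD _ _) _; rewrite !normcM normc_conj mulrDl.
apply: le_trans (le_normcD _ _) _; rewrite [leRHS]mulrDl lerD //; last first.
  by rewrite normcM expr2 mulrACA ler_pM ?normc_ge0.
apply: le_trans (le_normcD _ _) _; rewrite [leRHS]mulrDl lerD //.
  by rewrite normcM -mulrA ler_wpM2l ?normc_ge0.
by rewrite normcM mulrAC ler_pM ?normc_ge0.
Qed.

Lemma qdiff_exp (R : realType) (f : R[i] -> R[i]) (z al be : R[i]) n :
  qdiff f z al be -> qdiff (fun w => f w ^+ n) z
    (n%:R * f z ^+ n.-1 * al) (n%:R * f z ^+ n.-1 * be).
Proof.
move=> h; elim: n => [|n IH].
  rewrite !mul0r (_ : (fun _ => _) = fun=> 1); first exact: qdiff_cst.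
  by apply/funext => w; rewrite expr0.
have -> : (fun w => f w ^+ n.+1) = (fun w => f w * f w ^+ n).
  by apply/funext => w; rewrite exprS.
have E x : n.+1%:R * f z ^+ n.+1.-1 * x =
    x * f z ^+ n + f z * (n%:R * f z ^+ n.-1 * x).
  by case: n {IH} => [|n] /=; rewrite -?natr1 ?exprS ?expr0; ring.
by rewrite !E; apply: qdiff_mul.
Qed.

(** * From expansions to partial and Wirtinger derivatives *)

Lemma derive1_quadratic (R : realType) (f : R -> R) (x A C d : R) :
  0 < d -> (forall t, `|t - x| < d ->
    `|f t - f x - A * (t - x)| <= C * `|t - x| ^+ 2) ->
  derive1 f x = A.
Proof.
move=> d0 h; rewrite /derive1; apply: cvg_lim => //.
apply/cvgrPdist_lt => e e0; near=> t.
have t0 : t != 0 by near: t; exact: nbhs_dnbhs_neq.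
have td : `|t| < d.
  by near: t; apply: dnbhs0_lt.
have te : `|t| < e / (`|C| + 1).
  by near: t; apply: dnbhs0_lt; rewrite divr_gt0 // ltr_wpDl.
have := h (t + x); rewrite addrK => /(_ td) ht.
have -> : A - t^-1 *: (f (t + x) - f x) =
    - (t^-1 * (f (t + x) - f x - A * t)).
  by rewrite /GRing.scale /=; field.
rewrite normrN normrM normfV ltr_pdivrMl ?normr_gt0 //.
apply: le_lt_trans ht _; rewrite expr2 mulrCA ltr_pM2l ?normr_gt0 //.
move: te; rewrite ltr_pdivlMr ?ltr_wpDl // => te.
apply: le_lt_trans te; rewrite mulrC ler_wpM2l //.
by apply: le_trans (ler_norm _) _; rewrite lerDl.
Unshelve. all: by end_near.
Qed.

Lemma Re_affine (R : realType) (u v x : R[i]) (t : R) :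
  complex.Re (u - v - x * t%:C) =
  complex.Re u - complex.Re v - complex.Re x * t.
Proof. by case: u v x => [? ?] [? ?] [? ?] /=; rewrite mulr0 subr0. Qed.

Lemma Im_affine (R : realType) (u v x : R[i]) (t : R) :
  complex.Im (u - v - x * t%:C) =
  complex.Im u - complex.Im v - complex.Im x * t.
Proof. by case: u v x => [? ?] [? ?] [? ?] /=; rewrite mulr0 add0r. Qed.

(** Along a horizontal line w - z equals its conjugate; along a vertical line it is i times a real
    number and conjugation changes its sign. *)
Lemma qdiff_partial (R : realType) (f : R[i] -> R[i]) (z al be : R[i]) :
  qdiff f z al be ->
  partialx f z = al + be /\ partialy f z = 'i%C * (al - be).
Proof.
case: z => x y [C [d [C0 d0 h]]].
split; rewrite /partialx /partialy /=.
  have H t : `|t - x| < d -> normc (f (t +i* y) - f (x +i* y)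
      - (al + be) * (t - x)%:C) <= C * `|t - x| ^+ 2.
    have wz : (t +i* y) - (x +i* y) = (t - x)%:C by simpc.
    have := h (t +i* y); rewrite wz conjc_real normcR => {}h /h.
    by rewrite -mulrDl.
  rewrite (@derive1_quadratic _ _ x (complex.Re (al + be)) C d) //; last first.
    move=> t /H; apply: le_trans; apply: le_trans (ler_Re_normc _).
    by rewrite -Re_affine.
  rewrite (@derive1_quadratic _ _ x (complex.Im (al + be)) C d) //.
    by case: (al + be).
  move=> t /H; apply: le_trans; apply: le_trans (ler_Im_normc _).
  by rewrite -Im_affine.
have H t : `|t - y| < d -> normc (f (x +i* t) - f (x +i* y)
    - ('i%C * (al - be)) * (t - y)%:C) <= C * `|t - y| ^+ 2.
  have wz : (x +i* t) - (x +i* y) = 'i%C * (t - y)%:C by simpc.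
  have nE : normc ('i%C * (t - y)%:C) = `|t - y|.
    by rewrite normcM normcR /= expr0n expr1n add0r sqrtr1 mul1r.
  have cE : conjc ('i%C * (t - y)%:C) = - 'i%C * (t - y)%:C.
    by apply/eqP; rewrite eq_complex /=; apply/andP; split; apply/eqP; ring.
  have := h (x +i* t); rewrite wz nE cE => {}h /h.
  by congr (normc (_ - _) <= _); ring.
rewrite (@derive1_quadratic _ _ y (complex.Re ('i%C * (al - be))) C d) //;
    last first.
  move=> t /H; apply: le_trans; apply: le_trans (ler_Re_normc _).
  by rewrite -Re_affine.
rewrite (@derive1_quadratic _ _ y (complex.Im ('i%C * (al - be))) C d) //.
  by case: ('i%C * (al - be)).
move=> t /H; apply: le_trans; apply: le_trans (ler_Im_normc _).
by rewrite -Im_affine.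
Qed.

Lemma qdiff_wirtinger (R : realType) (f : R[i] -> R[i]) (z al be : R[i]) :
  qdiff f z al be -> dz f z = al /\ dzbar f z = be.
Proof.
move=> /qdiff_partial [px py]; rewrite /dz /dzbar px py.
have i2 : 'i%C * 'i%C = -1 :> R[i] by rewrite -expr2 sqr_i.
by rewrite mulrA i2; split; field.
Qed.

(** * Ellipticity *)

(** A null set cannot contain a square of positive area, so every small square around [z] has a
    point where [P] holds. *)
Lemma ae_disc_dense (R : realType) (P : R[i] -> Prop) (z : R[i]) (e : R) :
  ae_disc P -> disc z -> 0 < e ->
  exists w, [/\ normc (w - z) < e, disc w & P w].
Proof.
case: z => x y [A [mA A0 sA]] zd e0; apply: contrapT => /forallNP noP.
(* Half of the minimum, because a modulus is bounded by the sum of two coordinate distances, each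
   below [d]. *)
pose d := Num.min e (1 - normc (x +i* y)) / 2.
have d0 : 0 < d by rewrite divr_gt0 // lt_min e0 subr_gt0.
pose I t := `]t - d, t + d[%classic.
have rect : I x `*` I y `<=` A.
  move=> [s t] [/= sI tI]; apply: sA => /= hP.
  have wz : normc ((s +i* t) - (x +i* y)) < Num.min e (1 - normc (x +i* y)).
    apply: le_lt_trans (normc_le_ReIm _) _ => /=.
    have -> : Num.min e (1 - normc (x +i* y)) = d + d.
      by rewrite /d -splitr.
    move: sI tI; rewrite /I /= !in_itv /= => /andP[s1 s2] /andP[t1 t2].
    by apply: ltrD; rewrite ltr_norml; apply/andP; split; lra.
  have wd : disc (s +i* t).
    rewrite /disc /mkset -[s +i* t](subrK (x +i* y)).
    apply: le_lt_trans (le_normcD _ _) _; rewrite -ltrBrDr.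
    by move: wz; rewrite lt_min => /andP[].
  apply: (noP (s +i* t)); split=> //; last exact: hP.
  by move: wz; rewrite lt_min => /andP[].
have mI t : measurable (I t) by exact: measurable_itv.
have : (plane_measure R (I x `*` I y) <= 0)%E.
  rewrite -A0; apply: le_measure; rewrite ?inE; [|exact: mA|exact: rect].
  by apply: measurableX; exact: mI.
have EI t : lebesgue_measure (I t) = (d + d)%:E :> \bar R.
  rewrite /I lebesgue_measure_itv /= lte_fin -EFinB ltrD2l gtrN //.
  by congr (_%:E); ring.
have -> : plane_measure R (I x `*` I y) = ((d + d) * (d + d))%:E.
  transitivity (lebesgue_measure (I x) * lebesgue_measure (I y))%E.
    by apply: product_measure1E; exact: mI.
  by rewrite !EI EFinM.
rewrite lee_fin leNgt => /negP; apply.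
by rewrite mulr_gt0 // addr_gt0.
Qed.

(** Continuity in the topology of [R[i]^o] is restated with real distances, so that later limits are
    taken in the reals. *)
Lemma disc_continuous_cvg (R : realType) (f : R[i] -> R[i]) (z : R[i])
    (w : nat -> R[i]) :
  disc_continuous f -> disc z ->
  (fun n => normc (w n - z)) @ \oo --> (0 : R) ->
  (fun n => normc (f (w n) - f z)) @ \oo --> (0 : R).
Proof.
move=> fc zd wz; apply/cvgrPdist_lt => e e0.
have /cvgrPdist_lt/(_ e%:C) := fc z zd; rewrite ltcR => /(_ e0).
move=> /nbhs_normP[d d0 hd].
have dE : d = (complex.Re d)%:C by rewrite RRe_real // gtr0_real.
move/cvgrPdist_lt : wz => /(_ (complex.Re d)); rewrite -ltcR -dE => /(_ d0).
move=> [N _ hN]; exists N => // n /hN /=.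
rewrite !sub0r !normrN !(ger0_norm (normc_ge0 _)) => h.
rewrite -ltcR -norm_normc distrC; apply: hd => /=.
by rewrite distrC norm_normc dE ltcR.
Qed.

Lemma cvg_normc (R : realType) (u : nat -> R[i]) (l : R[i]) :
  (fun n => normc (u n - l)) @ \oo --> (0 : R) ->
  (fun n => normc (u n)) @ \oo --> normc l.
Proof.
move=> /cvgrPdist_lt h; apply/cvgrPdist_lt => e /h [N _ hN].
exists N => // n /hN /=; rewrite sub0r normrN ger0_norm ?normc_ge0 //.
apply: le_lt_trans; rewrite ler_norml; apply/andP; split.
  rewrite lerNl opprB lerBlDr; apply: le_trans (le_normcD _ _).
  by rewrite subrK.
rewrite lerBlDr normcB; apply: le_trans (le_normcD _ _).
by rewrite subrK.
Qed.

Lemma cvg_wirtinger (R : realType) (u v : nat -> R[i]) (a b : R[i]) :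
  (fun n => normc (u n - a)) @ \oo --> (0 : R) ->
  (fun n => normc (v n - b)) @ \oo --> (0 : R) ->
  (fun n => normc ((u n - 'i%C * v n) / 2%:R - (a - 'i%C * b) / 2%:R))
    @ \oo --> (0 : R) /\
  (fun n => normc ((u n + 'i%C * v n) / 2%:R - (a + 'i%C * b) / 2%:R))
    @ \oo --> (0 : R).
Proof.
move=> ua vb.
have i1 : normc ('i%C : R[i]) = 1 by rewrite /= expr0n expr1n add0r sqrtr1.
have lim : (fun n => (normc (u n - a) + normc (v n - b)) / 2) @ \oo --> (0 : R).
  rewrite -[X in _ --> X](mul0r (2^-1)) -[X in X * _](addr0 0).
  by apply: cvgMl; apply: cvgD.
split; apply: (squeeze_cvgr _ (cvg_cst 0) lim);
  apply: nearW => n; rewrite normc_ge0 -mulrBl normcM normcV normc_nat /=;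
  rewrite ler_wpM2r ?invr_ge0 //.
  have -> : u n - 'i%C * v n - (a - 'i%C * b) =
    (u n - a) - 'i%C * (v n - b) by ring.
  by apply: le_trans (le_normcD _ _) _; rewrite normcN normcM i1 mul1r.
have -> : u n + 'i%C * v n - (a + 'i%C * b) =
  (u n - a) + 'i%C * (v n - b) by ring.
by apply: le_trans (le_normcD _ _) _; rewrite normcM i1 mul1r.
Qed.

(** Both sides are continuous because [F] is continuously differentiable, so the inequality extends
    from a dense set to the whole disc. *)
Lemma elliptic_everywhere (R : realType) (K K' : R) (F : R[i] -> R[i]) :
  elliptic K K' F -> forall z, disc z ->
  Lambda_of F z ^+ 2 <= K * Jacobian_of F z + K'.
Proof.
move=> [[_ [_ [Fx _] [Fy _]]] _ _ _ Fae] z zd.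
have inv0 n : 0 < (n.+1%:R : R)^-1 by rewrite invr_gt0.
have [w hw] := choice (fun n => ae_disc_dense Fae zd (inv0 n)).
have wz : (fun n => normc (w n - z)) @ \oo --> (0 : R).
  apply: (squeeze_cvgr _ (cvg_cst 0) (@cvg_harmonic R)).
  by apply: nearW => n; rewrite normc_ge0 /=; have [/ltW] := hw n.
have [cz czb] := cvg_wirtinger (disc_continuous_cvg Fx zd wz)
  (disc_continuous_cvg Fy zd wz).
have {}cz : (fun n => normc (dz F (w n))) @ \oo --> normc (dz F z).
  exact: cvg_normc.
have {}czb : (fun n => normc (dzbar F (w n))) @ \oo --> normc (dzbar F z).
  exact: cvg_normc.
apply: (@ler_cvg_to _ \oo _ _ (fun n => Lambda_of F (w n) ^+ 2)
  (fun n => K * Jacobian_of F (w n) + K')).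
- by rewrite /Lambda_of; under eq_fun do rewrite expr2;
     rewrite expr2; apply: cvgM; apply: cvgD.
- apply: cvgD; last exact: cvg_cst.
  apply: cvgMr; apply: cvgB.
    by under eq_fun do rewrite expr2; rewrite expr2; exact: cvgM.
  by under eq_fun do rewrite expr2; rewrite expr2; exact: cvgM.
- by apply: nearW => n; have [_ _] := hw n.
Qed.

(** Let x and y be the moduli of F_z and F_zbar. Since J_F = (x + y)(x - y) with 0 <= x - y <= lam,
    ellipticity is a quadratic inequality in x + y, which gives x + y <= K lam + sqrt K'. The claim
    follows as 2 (x^2 + y^2) = (x + y)^2 + (x - y)^2. *)
Lemma elliptic_bound (R : realType) (K K' lam : R) (F : R[i] -> R[i]) z :
  1 <= K -> 0 <= K' -> elliptic K K' F ->
  (forall z, disc z -> lambda_of F z <= lam) -> disc z ->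
  2 * (normc (dz F z) ^+ 2 + normc (dzbar F z) ^+ 2) <=
  (K ^+ 2 + 1) * lam ^+ 2 + 2%:R * K * Num.sqrt K' * lam + K'.
Proof.
move=> K1 K'0 Fell Flam zd.
have := elliptic_everywhere Fell zd; have := Flam z zd.
have [_ J0 _ _ _] := Fell; have := J0 z zd.
rewrite /Lambda_of /lambda_of /Jacobian_of.
have := normc_ge0 (dz F z); have := normc_ge0 (dzbar F z).
move: (normc (dz F z)) (normc (dzbar F z)) => x y y0 x0 xy.
have {}xy : y <= x by rewrite -(@ler_pXn2r _ 2) ?nnegrE // -subr_ge0.
rewrite ger0_norm ?subr_ge0 // => hl hL.
have := sqr_sqrtr K'0; have := sqrtr_ge0 K'.
move: (Num.sqrt K') => q q0 qE; rewrite -{}qE in hL *.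
have K0 : 0 <= K by lra.
have lam0 : 0 <= lam by lra.
have Kl0 : 0 <= K * lam by rewrite mulr_ge0.
have hL' : (x + y) ^+ 2 <= K * lam * (x + y) + q ^+ 2.
  apply: le_trans hL _; rewrite lerD2r -mulrA ler_wpM2l // subr_sqr.
  by rewrite ler_wpM2r // addr_ge0.
(* If s = x + y were larger, then s (s - K lam) > s q >= q^2, against [hL']. *)
have xyq : x + y <= K * lam + q.
  rewrite leNgt; apply/negP => h.
  have s0 : 0 <= x + y by lra.
  have := ler_wpM2l q0 (ltW h); nra.
have s0 : 0 <= x + y by lra.
have d0 : 0 <= x - y by lra.
have : (x + y) ^+ 2 <= (K * lam + q) ^+ 2 by rewrite lerXn2r ?nnegrE //; lra.
have : (x - y) ^+ 2 <= lam ^+ 2 by rewrite lerXn2r.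
nra.
Qed.

(** * Discrete Parseval identity *)

(** Orders that are powers of two suffice for the averaging, and iterated square roots of -1 provide
    them: the order divides 2^(s+1) but not 2^s. *)
Lemma primitive_root_pow2 (R : realType) (s : nat) :
  exists w : R[i], (2 ^ s.+1).-primitive_root w.
Proof.
have [w ws] : exists w : R[i], w ^+ (2 ^ s) = -1.
  elim: s => [|s [w ws]]; first by exists (-1); rewrite expr1.
  by exists (sqrtC w); rewrite expnS exprM sqrtCK.
exists w; have w1 : w ^+ (2 ^ s.+1) = 1 by rewrite expnSr exprM ws sqrrN expr1n.
have [m pm] := prim_order_exists (expn_gt0 2 s.+1) w1.
move=> /(dvdn_pfactor _ _ (isT : prime 2))[t ts mE]; rewrite mE in pm.
move: ts; rewrite leq_eqVlt => /orP[/eqP <- //|]; rewrite ltnS => ts.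
have : w ^+ (2 ^ s) = 1.
  by apply/eqP; rewrite -(prim_order_dvd pm) dvdn_exp2l.
by rewrite ws => /eqP; rewrite eq_sym -subr_eq0 opprK (pnatr_eq0 _ 2).
Qed.

Lemma prim_root_normc (R : realType) N (w : R[i]) :
  N.-primitive_root w -> normc w = 1.
Proof.
move=> wN; apply/eqP; rewrite -(@pexpr_eq1 _ _ N) ?normc_ge0 //.
  by rewrite -normcX (prim_expr_order wN) normc1.
exact: prim_order_gt0 wN.
Qed.

Lemma sum_prim_root (F : fieldType) N (w : F) k : N.-primitive_root w ->
  \sum_(j < N) w ^+ (j * k) = if (N %| k)%N then N%:R else 0.
Proof.
move=> wN; case: ifPn => Nk.
  rewrite (eq_bigr (fun=> 1)) ?sumr_const ?card_ord // => j _.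
  by apply/eqP; rewrite -(prim_order_dvd wN) dvdn_mull.
have wk : w ^+ k - 1 != 0 by rewrite subr_eq0 -(prim_order_dvd wN).
apply: (mulfI wk); rewrite mulr0.
transitivity ((w ^+ k) ^+ N - 1).
  by rewrite [RHS]subrX1;
     congr (_ * _); apply: eq_bigr => j _; rewrite mulnC exprM.
by rewrite exprAC (prim_expr_order wN) expr1n subrr.
Qed.

(** The condition [M + M <= N] excludes aliasing: for indices in [1, M) no sum m + n is a multiple
    of N, and no difference m - n is one unless m = n. Sampling at roots of unity is then exact. *)
Lemma discrete_parseval (R : realType) N M (w : R[i]) (A B : nat -> R[i]) :
  N.-primitive_root w -> (M + M <= N)%N ->
  \sum_(j < N) normc (\sum_(1 <= n < M)
     (A n * (w ^+ j) ^+ n + B n * conjc ((w ^+ j) ^+ n))) ^+ 2 =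
  N%:R * \sum_(1 <= n < M) (normc (A n) ^+ 2 + normc (B n) ^+ 2).
Proof.
move=> wN MN; have N0 := prim_order_gt0 wN.
have wc : w * conjc w = 1.
  by rewrite -sqr_normcE (prim_root_normc wN) expr1n.
have wNc n : (n <= N)%N -> conjc w ^+ n = w ^+ (N - n).
  move=> nN; have w0 : w ^+ n != 0.
    by rewrite expf_neq0 //; apply: contraTneq (oner_neq0 R[i]) => w0;
       rewrite -wc w0 mul0r eqxx.
  apply: (mulfI w0); rewrite -exprMn wc expr1n -exprD subnKC //.
  by rewrite (prim_expr_order wN).
have wD m n : (0 < m)%N -> (0 < n)%N -> (m < M)%N -> (n < M)%N ->
    \sum_(j < N) (w ^+ j) ^+ m * (w ^+ j) ^+ n = 0.
  move=> m0 n0 mM nM.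
  under eq_bigr do rewrite -exprD -exprM.
  rewrite (sum_prim_root _ wN) gtnNdvd ?addn_gt0 ?m0 //.
  by apply: leq_trans MN; rewrite -addSn leq_add // ltnW.
have wB m n : (0 < m)%N -> (0 < n)%N -> (m < M)%N -> (n < M)%N ->
    \sum_(j < N) (w ^+ j) ^+ m * conjc ((w ^+ j) ^+ n) =
    if m == n then N%:R else 0.
  move=> m0 n0 mM nM.
  have nN : (n < N)%N by apply: leq_trans nM (leq_trans (leq_addr _ _) MN).
  have mN : (m < N)%N by apply: leq_trans mM (leq_trans (leq_addr _ _) MN).
  transitivity (\sum_(j < N) w ^+ (j * (m + (N - n)))).
    apply: eq_bigr => j _; rewrite -exprM exprAC rmorphXn /= rmorphXn /=.
    rewrite wNc ?(ltnW nN) // -exprM mulnDr exprD; congr (_ * _).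
    by rewrite mulnC.
  rewrite (sum_prim_root _ wN).
  have -> // : (N %| m + (N - n))%N = (m == n).
  apply/idP/eqP => [|->]; last by rewrite subnKC ?(ltnW nN).
  (* The exponent lies strictly between 0 and 2N, so N is the only multiple it can be. *)
  move=> /dvdnP[[|[|q]]] E; lia.
apply: complexI; rewrite rmorph_sum /=.
pose T (j : 'I_N) n := A n * (w ^+ j) ^+ n + B n * conjc ((w ^+ j) ^+ n).
transitivity (\sum_(1 <= m < M) \sum_(1 <= n < M) \sum_(j < N)
    T j m * conjc (T j n)).
  under eq_bigr do rewrite sqr_normcE rmorph_sum /= mulr_suml.
  rewrite exchange_big /=; apply: eq_bigr => m _.
  under eq_bigr do rewrite mulr_sumr.
  by rewrite exchange_big.
rewrite rmorphM rmorph_nat rmorph_sum mulr_sumr /=.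
apply: eq_big_nat => m /andP[m0 mM].
have E n : (0 < n)%N -> (n < M)%N -> \sum_(j < N) T j m * conjc (T j n) =
    if m == n then N%:R * (A m * conjc (A n) + B m * conjc (B n)) else 0.
  move=> n0 nM.
  (* Of the four products, the first two are evaluated by [wB], and the two mixed ones vanish by
     [wD]. *)
  transitivity (\sum_(j < N)
      (A m * conjc (A n) * ((w ^+ j) ^+ m * conjc ((w ^+ j) ^+ n)) +
      (B m * conjc (B n) * ((w ^+ j) ^+ n * conjc ((w ^+ j) ^+ m)) +
      (A m * conjc (B n) * ((w ^+ j) ^+ m * (w ^+ j) ^+ n) +
       B m * conjc (A n) * conjc ((w ^+ j) ^+ m * (w ^+ j) ^+ n))))).
    apply: eq_bigr => j _; rewrite /T.
    move: ((w ^+ j) ^+ m) ((w ^+ j) ^+ n) => x y.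
    by rewrite !(rmorphD, rmorphM) /= conjcK; ring.
  rewrite !big_split /= -!mulr_sumr !wB // -rmorph_sum /= !wD //.
  rewrite rmorph0 !mulr0 !addr0 [n == m]eq_sym.
  by case: eqP => _; rewrite ?mulr0 ?addr0 // -mulrDl mulrC.
rewrite (eq_big_nat _ _ (F2 := fun n => if m == n then
  N%:R * (A m * conjc (A n) + B m * conjc (B n)) else 0)); last first.
  by move=> n /andP[n0 nM]; rewrite E.
rewrite (bigD1_seq m) ?mem_index_iota ?m0 ?iota_uniq //= eqxx big1 ?addr0.
  by rewrite rmorphD /= !sqr_normcE.
by move=> n /negPf nm; rewrite eq_sym nm.
Qed.

(** * Uniform approximation and the coefficient inequality on a circle *)

Definition unif_approx (R : realType) (r : R) (f : nat -> R[i] -> R[i])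
    (g : R[i] -> R[i]) : Prop :=
  forall e : R, 0 < e -> exists M0, forall M, (M0 <= M)%N ->
    forall z, normc z <= r -> normc (f M z - g z) <= e.

Lemma unif_approx_psum (R : realType) (r : R) (c : nat -> R[i]) :
  0 < r -> r < 1 -> majorized c ->
  unif_approx r (fun M z => power_sum c z M) (psum c).
Proof.
move=> r0 r1 hc e e0.
have [C [s [s0 s1 hs]]] := psum_uniform hc r0 r1.
have lim : (fun n => `|C| * s ^+ n) @ \oo --> (0 : R).
  rewrite -[X in _ --> X](mulr0 `|C|); apply: cvgMr; apply: cvg_expr.
  by rewrite ger0_norm.
move/cvgrPdist_lt : lim => /(_ e e0)[M0 _ hM].
exists M0.+1 => -[//|M] M1 z zr; rewrite normcB.
have [_ h] := hs z zr; apply: le_trans (h _ _) _ => //.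
have := hM M.+1 (ltnW M1); rewrite /= sub0r normrN => /ltW.
apply: le_trans; apply: le_trans (ler_norm _).
by rewrite ler_wpM2r ?exprn_ge0 // ler_norm.
Qed.

Lemma unif_approx_conj (R : realType) (r : R) f (g : R[i] -> R[i]) :
  unif_approx r f g ->
  unif_approx r (fun M z => conjc (f M z)) (fun z => conjc (g z)).
Proof.
move=> h e /h[M0 hM]; exists M0 => M /hM {}hM z /hM.
by rewrite -rmorphB /= normc_conj.
Qed.

Lemma unif_approx_opp (R : realType) (r : R) f (g : R[i] -> R[i]) :
  unif_approx r f g -> unif_approx r (fun M z => - f M z) (fun z => - g z).
Proof.
move=> h e /h[M0 hM]; exists M0 => M /hM {}hM z /hM.
by rewrite -opprD normcN.
Qed.

Lemma unif_approx_add (R : realType) (r : R) f f' (g g' : R[i] -> R[i]) :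
  unif_approx r f g -> unif_approx r f' g' ->
  unif_approx r (fun M z => f M z + f' M z) (fun z => g z + g' z).
Proof.
move=> h h' e e0; have e2 : 0 < e / 2 by rewrite divr_gt0.
have [M0 hM] := h _ e2; have [M1 hM'] := h' _ e2.
exists (maxn M0 M1) => M; rewrite geq_max => /andP[/hM {}hM /hM' {}hM'] z zr.
have -> : f M z + f' M z - (g z + g' z) = (f M z - g z) + (f' M z - g' z).
  by ring.
rewrite (splitr e).
exact: le_trans (le_normcD _ _) (lerD (hM z zr) (hM' z zr)).
Qed.

Lemma unif_approx_mul (R : realType) (r B : R) f (g c : R[i] -> R[i]) :
  (forall z, normc z <= r -> normc (c z) <= B) -> unif_approx r f g ->
  unif_approx r (fun M z => c z * f M z) (fun z => c z * g z).
Proof.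
move=> cB h e e0; have B0 : 0 < `|B| + 1 by rewrite ltr_wpDl.
have [M0 hM] := h (e / (`|B| + 1)) (divr_gt0 e0 B0).
exists M0 => M /hM {}hM z zr; rewrite -mulrBr normcM.
have := hM z zr; rewrite ler_pdivlMr // => he; apply: le_trans he.
rewrite mulrC ler_wpM2l ?normc_ge0 //; apply: le_trans (cB z zr) _.
by apply: le_trans (ler_norm _) _; rewrite lerDl.
Qed.

Lemma unif_approx_sum (R : realType) (r : R) m n
    (f : nat -> nat -> R[i] -> R[i]) (g : nat -> R[i] -> R[i]) :
  (forall k, (m <= k < n)%N -> unif_approx r (f k) (g k)) ->
  unif_approx r (fun M z => \sum_(m <= k < n) f k M z)
    (fun z => \sum_(m <= k < n) g k z).
Proof.
elim: n => [|n IH] h.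
  by move=> e e0; exists 0%N => M _ z _; rewrite !big_geq // subrr normc0 ltW.
have [nm|mn] := ltnP n m.
  by move=> e e0; exists 0%N => M _ z _; rewrite !big_geq // subrr normc0 ltW.
have h1 : unif_approx r (f n) (g n) by apply: h; rewrite mn leqnn.
have h2 : unif_approx r (fun M z => \sum_(m <= k < n) f k M z)
    (fun z => \sum_(m <= k < n) g k z).
  by apply: IH => k /andP[mk kn]; apply: h; rewrite mk ltnW.
move=> e e0; have [M0 hM] := unif_approx_add h2 h1 e0.
exists M0 => M /hM {}hM z zr; rewrite !big_nat_recr //=; exact: hM.
Qed.

(** The pointwise bound is sampled at roots of unity, where Parseval is exact for the approximants
    [f M] and [g M]; averaging costs only the approximation error, which is arbitrarily small. *)
Lemma bessel_circle (R : realType) (r T : R) (f g : nat -> R[i] -> R[i])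
    (P Q : R[i] -> R[i]) (A B A' B' : nat -> R[i]) L :
  0 < r ->
  (forall M x, normc x = 1 -> f M (r%:C * x) =
     \sum_(1 <= n < M) (A n * x ^+ n + B n * conjc (x ^+ n))) ->
  (forall M x, normc x = 1 -> g M (r%:C * x) =
     \sum_(1 <= n < M) (A' n * x ^+ n + B' n * conjc (x ^+ n))) ->
  unif_approx r f P -> unif_approx r g Q ->
  (forall z, normc z = r -> normc (P z) ^+ 2 + normc (Q z) ^+ 2 <= T) ->
  \sum_(1 <= n < L) ((normc (A n) ^+ 2 + normc (B n) ^+ 2) +
                     (normc (A' n) ^+ 2 + normc (B' n) ^+ 2)) <= T.
Proof.
move=> r0 fE gE fP gQ PQ.
have nrx x : normc x = 1 -> normc (r%:C * x) = r.
  by move=> x1; rewrite normcM x1 mulr1 normcR gtr0_norm.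
have T0 : 0 <= T.
  apply: le_trans (PQ (r%:C * 1) (nrx _ (normc1 _))).
  by rewrite addr_ge0 ?sqr_ge0.
apply/ler_addgt0Pr => e e0.
(* With u, v <= T + 1 and d <= 1, (u + d)^2 + (v + d)^2 is at most T + d (4 (T + 1) + 2), so
   [d * D <= e] suffices. *)
pose D := 4 * (T + 1) + 2; have D0 : 0 < D by rewrite /D; lra.
pose d := Num.min 1 (e / D).
have d0 : 0 < d by rewrite lt_min ltr01 divr_gt0.
have d1 : d <= 1 by rewrite ge_min lexx.
have dD : d * D <= e by rewrite -ler_pdivlMr // ge_min lexx orbT.
have [M1 h1] := fP d d0; have [M2 h2] := gQ d d0.
pose M := maxn L (maxn M1 M2).
have [LM M1M M2M] : [/\ (L <= M)%N, (M1 <= M)%N & (M2 <= M)%N].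
  by rewrite /M !leq_max !leqnn !orbT.
(* The order 2^(M+1) is at least 2M, as the absence of aliasing requires. *)
have [w wN] := @primitive_root_pow2 R M; set N := (2 ^ M.+1)%N in wN.
have MN : (M + M <= N)%N.
  by rewrite addnn -mul2n /N expnS leq_mul2l /= ltnW // ltn_expl.
have N0 : 0 < N%:R :> R by rewrite ltr0n (prim_order_gt0 wN).
have wj j : normc (w ^+ j) = 1 by rewrite normcX (prim_root_normc wN) expr1n.
apply: (@le_trans _ _ (\sum_(1 <= n < M) ((normc (A n) ^+ 2 + normc (B n) ^+ 2) +
                     (normc (A' n) ^+ 2 + normc (B' n) ^+ 2)))).
  have [L0|L0] := posnP L.
    by rewrite L0 big_geq // sumr_ge0 // => n _; rewrite !addr_ge0 ?sqr_ge0.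
  rewrite [leRHS](big_cat_nat L0 LM) /= lerDl sumr_ge0 // => n _.
  by rewrite !addr_ge0 ?sqr_ge0.
rewrite -(ler_pM2l N0) big_split mulrDr /=.
rewrite -!(discrete_parseval _ _ wN MN) -big_split /=.
have -> : N%:R * (T + e) = \sum_(j < N) (T + e).
  by rewrite sumr_const card_ord mulr_natl.
apply: ler_sum => j _; rewrite -fE // -gE //.
have zr := nrx _ (wj j); set z := r%:C * _ in zr *.
have := PQ z zr; have := h1 M M1M z; rewrite zr => /(_ (lexx _)) h1z.
have := h2 M M2M z; rewrite zr => /(_ (lexx _)) h2z hPQ.
have hf : normc (f M z) <= normc (P z) + d.
  rewrite -[f M z](subrK (P z)) addrC.
  by apply: le_trans (le_normcD _ _) _; rewrite lerD2l.
have hg : normc (g M z) <= normc (Q z) + d.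
  rewrite -[g M z](subrK (Q z)) addrC.
  by apply: le_trans (le_normcD _ _) _; rewrite lerD2l.
have := normc_ge0 (f M z); have := normc_ge0 (g M z).
have := normc_ge0 (P z); have := normc_ge0 (Q z).
move: (normc (f M z)) (normc (g M z)) (normc (P z)) (normc (Q z)) hf hg hPQ.
move=> x y u v xu yv uvT v0 u0 y0 x0.
have xx : x ^+ 2 <= (u + d) ^+ 2 by rewrite lerXn2r ?nnegrE // addr_ge0 // ltW.
have yy : y ^+ 2 <= (v + d) ^+ 2 by rewrite lerXn2r ?nnegrE // addr_ge0 // ltW.
have u1 : u <= T + 1 by nra.
have v1 : v <= T + 1 by nra.
have du : d * u <= d * (T + 1) by rewrite ler_wpM2l // ltW.
have dv : d * v <= d * (T + 1) by rewrite ler_wpM2l // ltW.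
have dd : d * d <= d by rewrite ler_piMr // ltW.
move: dD; rewrite /D => dD; nra.
Qed.

(** * Cross terms and the passage to radius 1 *)

Lemma sqr_normcD (R : realType) (x y : R[i]) :
  normc (x + y) ^+ 2 =
  normc x ^+ 2 + normc y ^+ 2 + 2 * complex.Re (x * conjc y).
Proof.
case: x y => [a b] [c d] /=.
by rewrite !sqr_sqrtr ?addr_ge0 ?sqr_ge0 //; ring.
Qed.

Lemma Re_realM (R : realType) (t : R) (x : R[i]) :
  complex.Re (t%:C * x) = t * complex.Re x.
Proof. by case: x => a b /=; rewrite mul0r subr0. Qed.

Lemma Re_sum (R : realType) I (r : seq I) (P : pred I) (E : I -> R[i]) :
  complex.Re (\sum_(i <- r | P i) E i) = \sum_(i <- r | P i) complex.Re (E i).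
Proof. exact: raddf_sum. Qed.

(* Coefficients in a common right angle: all cross terms are nonnegative. *)
Lemma normc_sum_ge (R : realType) (t : nat -> R) (x : nat -> R[i]) m n :
  (forall k, 0 <= t k) ->
  (forall k l, (m <= k < n)%N -> (m <= l < n)%N ->
     0 <= complex.Re (x k * conjc (x l))) ->
  \sum_(m <= k < n) t k ^+ 2 * normc (x k) ^+ 2 <=
  normc (\sum_(m <= k < n) (t k)%:C * x k) ^+ 2.
Proof.
move=> t0; elim: n => [|n IH] h; first by rewrite !big_geq // normc0 expr0n.
have [nm|mn] := ltnP n m; first by rewrite !big_geq // normc0 expr0n.
rewrite !big_nat_recr //=; set X := \sum_(m <= k < n) _ * x k in IH *.
have XE : 0 <= complex.Re (X * conjc ((t n)%:C * x n)).
  have -> : conjc ((t n)%:C * x n) = (t n)%:C * conjc (x n).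
    by rewrite -[in RHS]conjc_real rmorphM.
  rewrite mulrCA Re_realM mulr_ge0 //.
  rewrite /X mulr_suml Re_sum big_nat_cond sumr_ge0 // => k.
  rewrite andbT => /andP[mk kn]; rewrite -mulrA Re_realM mulr_ge0 //.
  by apply: h; rewrite ?mk ?mn ?leqnn // ltnW.
rewrite sqr_normcD normcM normcR ger0_norm // exprMn.
have {}IH : \sum_(m <= k < n) t k ^+ 2 * normc (x k) ^+ 2 <= normc X ^+ 2.
  by apply: IH => k l /andP[mk kn] /andP[ml ln]; apply: h;
     rewrite ?mk ?ml ltnW.
by move: IH XE; lra.
Qed.

(** Bernoulli's inequality replaces a limit: for r = 1 - d the loss X - X r^E is at most X E d. *)
Lemma pow_limit_le (R : realType) (X S : R) E : 0 <= X ->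
  (forall r, 0 < r -> r < 1 -> X * r ^+ E <= S) -> X <= S.
Proof.
move=> X0 h; apply/ler_addgt0Pr => e e0.
have bern (d : R) : 0 <= d -> d <= 1 -> 1 - E%:R * d <= (1 - d) ^+ E.
  move=> d0 d1; elim: E {h} => [|E IH]; first by rewrite mul0r subr0 expr0.
  have s0 : 0 <= 1 - d by rewrite subr_ge0.
  rewrite exprS; apply: le_trans (ler_wpM2l s0 IH).
  have := mulr_ge0 (ler0n R E) (sqr_ge0 d); rewrite -natr1; nra.
pose D := X * E%:R + 1; have XE : 0 <= X * E%:R by rewrite mulr_ge0.
have D0 : 0 < D by rewrite ltr_wpDl.
(* The bound 1/2 keeps 1 - d inside ]0, 1[, and [e / D] makes the loss at most [e]. *)
pose d := Num.min (1 / 2) (e / D).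
have d0 : 0 < d by rewrite lt_min divr_gt0 // divr_gt0.
have d2 : d <= 1 / 2 by rewrite ge_min lexx.
have dD : d * D <= e by rewrite -ler_pdivlMr // ge_min lexx orbT.
have hS : X * (1 - d) ^+ E <= S by apply: h; lra.
have d1 : d <= 1 by lra.
have := ler_wpM2l X0 (bern d (ltW d0) d1).
move: dD; rewrite /D; nra.
Qed.

(** * Coefficients of an Almansi expansion *)

(** The operator z d/dz + conj z d/dzbar multiplies |z|^(2m) by 2m, while z d/dz - conj z d/dzbar
    annihilates it; on the analytic and conjugated parts both act through the Euler operator. At z =
    0 the two identities carry no information, hence the third clause. *)
Lemma almansi_wirtinger (R : realType) (p : nat) (a b : nat -> nat -> R[i])
    (a0 : R[i]) (F : R[i] -> R[i]) (z : R[i]) :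
  (forall k, (1 <= k < p.+1)%N -> majorized (a^~ k)) ->
  (forall k, (1 <= k < p.+1)%N -> majorized (b^~ k)) ->
  (forall w, disc w -> F w = a0 + \sum_(1 <= k < p.+1)
     (w * conjc w) ^+ k.-1 * (psum (a^~ k) w + conjc (psum (b^~ k) w))) ->
  disc z ->
  [/\ z * dz F z + conjc z * dzbar F z = \sum_(1 <= k < p.+1)
        (z * conjc z) ^+ k.-1 *
        ((2 * k.-1)%:R * (psum (a^~ k) z + conjc (psum (b^~ k) z)) +
         (psum (euler_coef (a^~ k)) z +
          conjc (psum (euler_coef (b^~ k)) z))),
      z * dz F z - conjc z * dzbar F z = \sum_(1 <= k < p.+1)
        (z * conjc z) ^+ k.-1 *
        (psum (euler_coef (a^~ k)) z -
         conjc (psum (euler_coef (b^~ k)) z)) &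
      (0 < p)%N -> z = 0 ->
        dz F z = a 1%N 1%N /\ dzbar F z = conjc (b 1%N 1%N)].
Proof.
move=> ha hb FE zd.
have /choice[da hda] k : exists x, (1 <= k < p.+1)%N ->
    [/\ qdiff (psum (a^~ k)) z x 0, z * x = psum (euler_coef (a^~ k)) z &
        z = 0 -> x = a 1%N k].
  have [/ha hk|_] := boolP (1 <= k < p.+1)%N; last by exists 0.
  by have [x hx] := psum_qdiff hk zd; exists x.
have /choice[db hdb] k : exists x, (1 <= k < p.+1)%N ->
    [/\ qdiff (psum (b^~ k)) z x 0, z * x = psum (euler_coef (b^~ k)) z &
        z = 0 -> x = b 1%N k].
  have [/hb hk|_] := boolP (1 <= k < p.+1)%N; last by exists 0.
  by have [x hx] := psum_qdiff hk zd; exists x.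
pose u k w := psum (a^~ k) w + conjc (psum (b^~ k) w).
(* For k = 1 the truncated exponent [k.-2] is harmless, since the factor [k.-1] is 0. *)
pose al k (w : R[i]) := k.-1%:R * (w * conjc w) ^+ k.-2 * conjc w * u k w +
  (w * conjc w) ^+ k.-1 * da k.
pose be k (w : R[i]) := k.-1%:R * (w * conjc w) ^+ k.-2 * w * u k w +
  (w * conjc w) ^+ k.-1 * conjc (db k).
have hq k : (1 <= k < p.+1)%N ->
    qdiff (fun w => (w * conjc w) ^+ k.-1 * u k w) z (al k z) (be k z).
  move=> hk; have [qa _ _] := hda k hk; have [qb _ _] := hdb k hk.
  have q1 := qdiff_mul (qdiff_id z) (qdiff_conj (qdiff_id z)).
  have := qdiff_mul (qdiff_exp k.-1 q1) (qdiff_add qa (qdiff_conj qb)).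
  rewrite !(conjc0, conjc1) !(mulr0, mul0r, mulr1, mul1r, addr0, add0r).
  exact.
have [dzE dzbE] := qdiff_wirtinger (qdiff_ext zd FE
  (qdiff_add (qdiff_cst a0 z) (qdiff_sum hq))).
rewrite dzE dzbE !add0r; split.
- rewrite !mulr_sumr -big_split /=; apply: eq_big_nat => k hk.
  have [_ <- _] := hda k hk; have [_ dbE _] := hdb k hk.
  rewrite -dbE rmorphM /= /al /be /u -/(u k z).
  by case: k.-1 => [|m] /=; rewrite ?exprS natrM; ring.
- rewrite !mulr_sumr -sumrB /=; apply: eq_big_nat => k hk.
  have [_ <- _] := hda k hk; have [_ dbE _] := hdb k hk.
  rewrite -dbE rmorphM /= /al /be.
  by ring.
move=> p0 z0; rewrite ![\sum_(1 <= _ < _) _]big_ltn //.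
rewrite /al /be z0 conjc0 /= !(mulr0, mul0r, expr0, mul1r, add0r).
have h1 : (1 <= 1 < p.+1)%N by rewrite leqnn ltnS.
have [_ _ /(_ z0) ->] := hda _ h1; have [_ _ /(_ z0) ->] := hdb _ h1.
(* For i >= 2 both summands contain a positive power of 0. *)
have zero (x : nat -> R[i]) : \sum_(2 <= i < p.+1)
    (i.-1%:R * 0 ^+ i.-2 * 0 * u i 0 + 0 ^+ i.-1 * x i) = 0.
  rewrite big_nat_cond big1 // => i /andP[/andP[i2 _] _].
  by case: i i2 => [|[|i]] //= _; rewrite exprS !(mulr0, mul0r) addr0.
by rewrite !zero !addr0.
Qed.

Lemma parallelogram (R : realType) (x y : R[i]) :
  normc (x + y) ^+ 2 + normc (x - y) ^+ 2 =
  2 * (normc x ^+ 2 + normc y ^+ 2).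
Proof.
rewrite !sqr_normcD normcN rmorphN mulrN /=.
have -> : complex.Re (- (x * conjc y)) = - complex.Re (x * conjc y).
  by case: (x * _).
by ring.
Qed.

Lemma power_sum_conj (R : realType) (c : nat -> R[i]) z M :
  conjc (power_sum c z M) = \sum_(1 <= n < M) conjc (c n) * conjc (z ^+ n).
Proof.
by rewrite /power_sum rmorph_sum; apply: eq_bigr => n _; rewrite rmorphM.
Qed.

Lemma conjc_realM (R : realType) (t : R) (x : R[i]) :
  conjc (t%:C * x) = t%:C * conjc x.
Proof. by rewrite -[in RHS]conjc_real rmorphM. Qed.

(** On the circle of radius |r| the factor (z conj z)^m is the constant r^(2m), so a trigonometric
    polynomial remains; the Euler sums contribute n to the weight and the radial factor 2m. *)
Lemma almansi_circle_add (R : realType) (r : R) (x : R[i])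
    (a b : nat -> R[i]) m M : normc x = 1 ->
  ((r%:C * x) * conjc (r%:C * x)) ^+ m *
    ((2 * m)%:R * (power_sum a (r%:C * x) M +
                   conjc (power_sum b (r%:C * x) M)) +
     (power_sum (euler_coef a) (r%:C * x) M +
      conjc (power_sum (euler_coef b) (r%:C * x) M))) =
  \sum_(1 <= n < M)
    (((n + 2 * m)%:R * r ^+ (n + 2 * m))%:C * a n * x ^+ n +
     ((n + 2 * m)%:R * r ^+ (n + 2 * m))%:C * conjc (b n) * conjc (x ^+ n)).
Proof.
move=> x1; rewrite -sqr_normcE normcM x1 mulr1 normcR real_normK ?num_real //.
rewrite !power_sum_conj /power_sum -!big_split /= mulr_sumr -big_split /=.
rewrite mulr_sumr; apply: eq_bigr => n _.
have -> : (r%:C * x) ^+ n = (r ^+ n)%:C * x ^+ n by rewrite exprMn rmorphXn.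
have -> : conjc (euler_coef b n) = n%:R%:C * conjc (b n).
  by rewrite -conjc_realM rmorph_nat.
have -> : (r ^+ 2)%:C ^+ m = (r ^+ (2 * m))%:C by rewrite -rmorphXn /= exprM.
rewrite conjc_realM /euler_coef exprD natrD !(rmorphM, rmorphD, rmorph_nat).
by ring.
Qed.

Lemma almansi_circle_sub (R : realType) (r : R) (x : R[i])
    (a b : nat -> R[i]) m M : normc x = 1 ->
  ((r%:C * x) * conjc (r%:C * x)) ^+ m *
    (power_sum (euler_coef a) (r%:C * x) M -
     conjc (power_sum (euler_coef b) (r%:C * x) M)) =
  \sum_(1 <= n < M)
    ((n%:R * r ^+ (n + 2 * m))%:C * a n * x ^+ n +
     (n%:R * r ^+ (n + 2 * m))%:C * - conjc (b n) * conjc (x ^+ n)).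
Proof.
move=> x1; rewrite -sqr_normcE normcM x1 mulr1 normcR real_normK ?num_real //.
rewrite !power_sum_conj /power_sum -sumrB mulr_sumr; apply: eq_bigr => n _.
have -> : (r%:C * x) ^+ n = (r ^+ n)%:C * x ^+ n by rewrite exprMn rmorphXn.
have -> : conjc (euler_coef b n) = n%:R%:C * conjc (b n).
  by rewrite -conjc_realM rmorph_nat.
have -> : (r ^+ 2)%:C ^+ m = (r ^+ (2 * m))%:C by rewrite -rmorphXn /= exprM.
rewrite conjc_realM /euler_coef exprD !(rmorphM, rmorphD, rmorph_nat).
by ring.
Qed.

Lemma mul_conjc_bound (R : realType) (r : R) m (z : R[i]) :
  r < 1 -> normc z <= r -> normc ((z * conjc z) ^+ m) <= 1.
Proof.
move=> r1 zr; have z1 : normc z <= 1 by apply: le_trans zr (ltW r1).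
rewrite normcX normcM normc_conj exprn_ile1 ?mulr_ge0 ?normc_ge0 //.
by rewrite mulr_ile1 ?normc_ge0.
Qed.

Lemma almansi_parseval_le (R : realType) (p : nat) (a b : nat -> nat -> R[i])
    (a0 : R[i]) (F : R[i] -> R[i]) (S : R) L :
  (forall k, (1 <= k < p.+1)%N -> majorized (a^~ k)) ->
  (forall k, (1 <= k < p.+1)%N -> majorized (b^~ k)) ->
  (forall w, disc w -> F w = a0 + \sum_(1 <= k < p.+1)
     (w * conjc w) ^+ k.-1 * (psum (a^~ k) w + conjc (psum (b^~ k) w))) ->
  (forall n k l, (0 < n)%N -> (1 <= k < p.+1)%N -> (1 <= l < p.+1)%N ->
     0 <= complex.Re (a n k * conjc (a n l))) ->
  (forall n k l, (0 < n)%N -> (1 <= k < p.+1)%N -> (1 <= l < p.+1)%N ->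
     0 <= complex.Re (b n k * conjc (b n l))) ->
  (forall z, disc z ->
     2 * (normc (dz F z) ^+ 2 + normc (dzbar F z) ^+ 2) <= S) ->
  \sum_(1 <= n < L) \sum_(1 <= k < p.+1)
    (n%:R ^+ 2 + (n + 2 * k.-1)%:R ^+ 2) *
    (normc (a n k) ^+ 2 + normc (b n k) ^+ 2) <= S.
Proof.
move=> ha hb FE aRe bRe FS.
have T0 n k : 0 <= (n%:R ^+ 2 + (n + 2 * k.-1)%:R ^+ 2) *
    (normc (a n k) ^+ 2 + normc (b n k) ^+ 2).
  by rewrite mulr_ge0 ?addr_ge0 ?sqr_ge0.
(* This exponent dominates every 2 (n + 2(k - 1)) with n < L and k <= p, so one power of r < 1
   serves all terms. *)
apply: (@pow_limit_le _ _ _ (2 * (L + 2 * p))).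
  by rewrite sumr_ge0 // => n _; rewrite sumr_ge0.
move=> r r0 r1.
pose c n k : R := (n + 2 * k.-1)%:R * r ^+ (n + 2 * k.-1).
pose d n k : R := n%:R * r ^+ (n + 2 * k.-1).
have c0 n k : 0 <= c n k by rewrite mulr_ge0 ?exprn_ge0 // ltW.
have d0 n k : 0 <= d n k by rewrite mulr_ge0 ?exprn_ge0 // ltW.
(* On |z| = r, [A] and [B] are the coefficients of z F_z + conj z F_zbar, and [A'] and [B'] those of
   the difference. *)
pose A n := \sum_(1 <= k < p.+1) (c n k)%:C * a n k.
pose B n := \sum_(1 <= k < p.+1) (c n k)%:C * conjc (b n k).
pose A' n := \sum_(1 <= k < p.+1) (d n k)%:C * a n k.
pose B' n := \sum_(1 <= k < p.+1) (d n k)%:C * - conjc (b n k).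
have uniform (f : nat -> nat -> R[i]) k :
    (1 <= k < p.+1)%N -> (forall k, (1 <= k < p.+1)%N -> majorized (f^~ k)) ->
    unif_approx r (fun M z => power_sum (f^~ k) z M) (psum (f^~ k)) /\
    unif_approx r (fun M z => power_sum (euler_coef (f^~ k)) z M)
      (psum (euler_coef (f^~ k))).
  move=> hk hf; split; apply: unif_approx_psum => //; first exact: hf.
  by apply: majorized_euler; exact: hf.
have key : \sum_(1 <= n < L) ((normc (A n) ^+ 2 + normc (B n) ^+ 2) +
    (normc (A' n) ^+ 2 + normc (B' n) ^+ 2)) <= S.
  apply: (@bessel_circle R r S
    (fun M z => \sum_(1 <= k < p.+1) (z * conjc z) ^+ k.-1 *
        ((2 * k.-1)%:R * (power_sum (a^~ k) z M +
                          conjc (power_sum (b^~ k) z M)) +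
         (power_sum (euler_coef (a^~ k)) z M +
          conjc (power_sum (euler_coef (b^~ k)) z M))))
    (fun M z => \sum_(1 <= k < p.+1) (z * conjc z) ^+ k.-1 *
        (power_sum (euler_coef (a^~ k)) z M -
         conjc (power_sum (euler_coef (b^~ k)) z M)))
    (fun z => \sum_(1 <= k < p.+1) (z * conjc z) ^+ k.-1 *
        ((2 * k.-1)%:R * (psum (a^~ k) z + conjc (psum (b^~ k) z)) +
         (psum (euler_coef (a^~ k)) z +
          conjc (psum (euler_coef (b^~ k)) z))))
    (fun z => \sum_(1 <= k < p.+1) (z * conjc z) ^+ k.-1 *
        (psum (euler_coef (a^~ k)) z -
         conjc (psum (euler_coef (b^~ k)) z)))) => //.
  - move=> M x x1; under eq_bigr do rewrite (almansi_circle_add _ _ _ _ _ x1).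
    rewrite exchange_big /=; apply: eq_bigr => n _.
    by rewrite /A /B !mulr_suml -big_split.
  - move=> M x x1; under eq_bigr do rewrite (almansi_circle_sub _ _ _ _ _ x1).
    rewrite exchange_big /=; apply: eq_bigr => n _.
    by rewrite /A' /B' !mulr_suml -big_split.
  - apply: unif_approx_sum => k hk.
    have [ua uea] := uniform _ k hk ha; have [ub ueb] := uniform _ k hk hb.
    apply: (@unif_approx_mul _ _ 1) => [z|]; first exact: mul_conjc_bound.
    apply: unif_approx_add; last first.
      exact: (unif_approx_add uea (unif_approx_conj ueb)).
    apply: (@unif_approx_mul _ _ (2 * k.-1)%:R) => [z _|].
      by rewrite normc_nat.
    exact: (unif_approx_add ua (unif_approx_conj ub)).
  - apply: unif_approx_sum => k hk.
    have [ua uea] := uniform _ k hk ha; have [ub ueb] := uniform _ k hk hb.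
    apply: (@unif_approx_mul _ _ 1) => [z|]; first exact: mul_conjc_bound.
    exact: (unif_approx_add uea (unif_approx_opp (unif_approx_conj ueb))).
  - move=> z zr; have zd : disc z by rewrite /disc /mkset zr.
    have [<- <- _] := almansi_wirtinger ha hb FE zd.
    (* Both summands scale by |z|^2 = r^2 <= 1, which reduces the bound to [FS]. *)
    rewrite parallelogram (normcM z) (normcM (conjc z)) normc_conj zr.
    rewrite !exprMn -mulrDr.
    apply: le_trans (FS z zd); rewrite ler_wpM2l // ler_piMl ?addr_ge0 ?sqr_ge0 //.
    by rewrite expr2 mulr_ile1 // ltW.
apply: le_trans key; rewrite mulr_suml; apply: ler_sum_nat => n /andP[n0 nL].
apply: (@le_trans _ _
  ((\sum_(1 <= k < p.+1) c n k ^+ 2 * normc (a n k) ^+ 2 +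
    \sum_(1 <= k < p.+1) c n k ^+ 2 * normc (conjc (b n k)) ^+ 2) +
   (\sum_(1 <= k < p.+1) d n k ^+ 2 * normc (a n k) ^+ 2 +
    \sum_(1 <= k < p.+1) d n k ^+ 2 * normc (- conjc (b n k)) ^+ 2))).
  rewrite -!big_split /= mulr_suml; apply: ler_sum_nat => k /andP[k1 kp].
  rewrite normcN normc_conj.
  have hr : r ^+ (2 * (L + 2 * p)) <= r ^+ (n + 2 * k.-1) ^+ 2.
    have le : ((n + 2 * k.-1) * 2 <= 2 * (L + 2 * p))%N.
      by move: k1 kp nL; clear; lia.
    by rewrite -exprM; apply: ler_wiXn2l => //; exact: ltW.
  apply: le_trans (ler_wpM2l (T0 n k) hr) _; rewrite /c /d le_eqVlt.
  by apply/orP; left; apply/eqP; ring.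
(* Conjugating both factors preserves the real part of a cross term, so the condition on [b] applies
   to the conjugated coefficients. *)
have Rc (x y : R[i]) : complex.Re (conjc x * conjc (conjc y)) =
    complex.Re (x * conjc y).
  by case: x y => [? ?] [? ?] /=; ring.
apply: lerD; apply: lerD; apply: normc_sum_ge => // k l hk hl.
- exact: aRe.
- by rewrite Rc; exact: bRe.
- exact: aRe.
- by rewrite rmorphN mulrNN /= Rc; exact: bRe.
Qed.

(** * From the weighted double sum to single coefficients *)

(** x conj y is |y|^2 times x / y, whose real part has the sign of the cosine of its argument. Zero
    coefficients, which the argument condition excludes, give a zero product. *)
Lemma principal_arg_Re (R : realType) (x y : R[i]) :
  (x != 0 -> y != 0 -> `|principal_arg (x / y)| <= pi / 2%:R) ->
  0 <= complex.Re (x * conjc y).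
Proof.
have [->|x0] := eqVneq x 0; first by move=> _; rewrite mul0r.
have [->|y0] := eqVneq y 0; first by move=> _; rewrite conjc0 mulr0.
move=> /(_ isT isT) hxy.
have [_ xyE] := principal_argP (mulf_neq0 x0 (invr_neq0 y0)).
have cos0 : 0 <= cos (principal_arg (x / y)).
  by apply: cos_ge0_pihalf; rewrite -ler_norml.
have -> : x * conjc y = (normc y ^+ 2)%:C * (x / y).
  by rewrite sqr_normcE; field.
rewrite Re_realM mulr_ge0 ?sqr_ge0 // xyE Re_realM mulr_ge0 ?normc_ge0 //.
Qed.

Lemma ler_term_sum_nat (R : realType) (g : nat -> R) m n i :
  (forall k, 0 <= g k) -> (m <= i < n)%N -> g i <= \sum_(m <= k < n) g k.
Proof.
move=> g0 hi; rewrite (bigD1_seq i) ?mem_index_iota ?iota_uniq //= lerDl.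
by rewrite sumr_ge0.
Qed.

Lemma ler_two_terms_sum_nat (R : realType) (g : nat -> R) m n i j :
  (forall k, 0 <= g k) -> (m <= i < n)%N -> (m <= j < n)%N -> i != j ->
  g i + g j <= \sum_(m <= k < n) g k.
Proof.
move=> g0 hi hj ij; rewrite (bigD1_seq i) ?mem_index_iota ?iota_uniq //= lerD2l.
rewrite -big_filter (bigD1_seq j) ?filter_uniq ?iota_uniq //=; last first.
  by rewrite mem_filter mem_index_iota eq_sym ij.
by rewrite lerDl sumr_ge0.
Qed.

(** The (1,1) term must survive beside the chosen one, since it supplies the subtracted 1 / (K +
    K'). The two terms lie in different rows when n differs from 1, and both in the first row
    otherwise. *)
Lemma double_sum_two_terms (R : realType) (G : nat -> nat -> R) (p : nat)
    (S : R) n k :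
  (forall n k, 0 <= G n k) -> (0 < n)%N -> (1 <= k <= p)%N ->
  (n != 1%N) || (k != 1%N) ->
  (forall L, \sum_(1 <= i < L) \sum_(1 <= j < p.+1) G i j <= S) ->
  G 1%N 1%N + G n k <= S.
Proof.
move=> G0 n0 /andP[k1 kp] nk hS.
have [L0 kL] : (1 <= 1 < p.+1)%N /\ (1 <= k < p.+1)%N by lia.
have H0 i : 0 <= \sum_(1 <= j < p.+1) G i j by rewrite sumr_ge0.
have [n1|n1] := eqVneq n 1%N; last first.
  apply: le_trans (hS n.+1); apply: (@le_trans _ _
    (\sum_(1 <= j < p.+1) G 1%N j + \sum_(1 <= j < p.+1) G n j)).
    by apply: lerD; apply: ler_term_sum_nat.
  apply: (@ler_two_terms_sum_nat _ (fun i => \sum_(1 <= j < p.+1) G i j)) => //;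
    by [lia | rewrite eq_sym].
rewrite n1 eqxx /= in nk *.
apply: le_trans (hS 2%N); rewrite big_nat1.
by apply: ler_two_terms_sum_nat => //; rewrite eq_sym.
Qed.

(** By (x + y)^2 <= 2 (x^2 + y^2), a weight [D] on the squares yields any divisor [d] with d^2 <= D
    / 2. *)
Lemma sum_normc_le_sqrt (R : realType) (x y T D d : R) :
  0 <= x -> 0 <= y -> 0 < d -> 2 * d ^+ 2 <= D ->
  D * (x ^+ 2 + y ^+ 2) <= T -> x + y <= Num.sqrt T / d.
Proof.
move=> x0 y0 d0 dD DT; rewrite ler_pdivlMr //.
have xy0 : 0 <= x + y by rewrite addr_ge0.
have xd0 : 0 <= (x + y) * d by rewrite mulr_ge0 // ltW.
rewrite -(ger0_norm xd0) -sqrtr_sqr ler_wsqrtr // exprMn.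
apply: le_trans DT; apply: le_trans (_ : 2 * d ^+ 2 * (x ^+ 2 + y ^+ 2) <= _).
  rewrite [leRHS]mulrAC ler_wpM2r ?sqr_ge0 //.
  by have := sqr_ge0 (x - y); nra.
by rewrite ler_wpM2r // addr_ge0 ?sqr_ge0.
Qed.

Theorem theorem2p5 (R : realType) (K K' lam : R) (p : nat)
    (F : R[i] -> R[i]) (a0 : R[i]) (a b : nat -> nat -> R[i])
    (hK : 1 <= K) (hK' : 0 <= K') (hp : (1 <= p)%N)
    (Fharm : polyharmonic p F) (Fell : elliptic K K' F)
    (a_analytic : forall k, (1 <= k <= p)%N -> forall z, disc z ->
       cvgn (power_sum (fun n => a n k) z))
    (b_analytic : forall k, (1 <= k <= p)%N -> forall z, disc z ->
       cvgn (power_sum (fun n => b n k) z))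
    (Fseries : forall z, disc z ->
       F z = a0 + \sum_(1 <= k < p.+1) (normc z ^+ (2 * (k - 1)))%:C *
         limn ((fun N => \sum_(1 <= n < N)
                  (a n k * z ^+ n + conjc (b n k * z ^+ n))) : nat -> R[i]^o))
    (a_arg : forall n k1 k2, (1 <= n)%N -> (1 <= k1 <= p)%N ->
       (1 <= k2 <= p)%N -> a n k1 != 0 -> a n k2 != 0 ->
       `|principal_arg (a n k1 / a n k2)| <= pi / 2%:R)
    (b_arg : forall n k3 k4, (1 <= n)%N -> (1 <= k3 <= p)%N ->
       (1 <= k4 <= p)%N -> b n k3 != 0 -> b n k4 != 0 ->
       `|principal_arg (b n k3 / b n k4)| <= pi / 2%:R)
    (Flam : forall z, disc z -> lambda_of F z <= lam)
    (F0 : F 0 = 0) (JF0 : Jacobian_of F 0 = 1) :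
  let M := Num.sqrt ((K ^+ 2 + 1) * lam ^+ 2 + 2%:R * K * Num.sqrt K' * lam
                     + K' - (K + K')^-1) in
  [/\ forall n, (2 <= n)%N -> normc (a n 1%N) + normc (b n 1%N) <= M / n%:R,
      forall n k, (2 <= n)%N -> (2 <= k <= p)%N ->
        normc (a n k) + normc (b n k) <= M / Num.sqrt 10%:R &
      forall k, (2 <= k <= p)%N ->
        normc (a 1%N k) + normc (b 1%N k) <= M / Num.sqrt 5%:R].
Proof.
set S0 := (K ^+ 2 + 1) * lam ^+ 2 + 2%:R * K * Num.sqrt K' * lam + K'.
move=> M.
have FS z : disc z -> 2 * (normc (dz F z) ^+ 2 + normc (dzbar F z) ^+ 2) <= S0.
  exact: elliptic_bound.
have ha k : (1 <= k < p.+1)%N -> majorized (a^~ k).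
  by move=> hk; apply: cvg_majorized; apply: a_analytic.
have hb k : (1 <= k < p.+1)%N -> majorized (b^~ k).
  by move=> hk; apply: cvg_majorized; apply: b_analytic.
(* The limit of the joint series splits into an analytic and a conjugated part, each convergent by
   [psum_cvg]. *)
have FE z : disc z -> F z = a0 + \sum_(1 <= k < p.+1)
    (z * conjc z) ^+ k.-1 * (psum (a^~ k) z + conjc (psum (b^~ k) z)).
  move=> zd; rewrite Fseries //; congr (_ + _); apply: eq_big_nat => k hk.
  rewrite subn1 exprM rmorphXn /= sqr_normcE; congr (_ * _).
  apply: limc_eq; apply/cvgcP => e e0; have e2 : 0 < e / 2 by rewrite divr_gt0.
  have [N1 h1] := proj1 (cvgcP _ _) (psum_cvg (ha k hk) zd) _ e2.
  have [N2 h2] := proj1 (cvgcP _ _) (psum_cvg (hb k hk) zd) _ e2.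
  exists (maxn N1 N2) => n; rewrite geq_max => /andP[/h1 {}h1 /h2 {}h2].
  rewrite big_split /= -rmorph_sum /= opprD addrACA -rmorphB.
  apply: le_lt_trans (le_normcD _ _) _.
  by rewrite (splitr e) normc_conj; apply: ltrD; [exact: h1 | exact: h2].
have aRe n k l : (0 < n)%N -> (1 <= k < p.+1)%N -> (1 <= l < p.+1)%N ->
    0 <= complex.Re (a n k * conjc (a n l)).
  by move=> n0 hk hl; apply: principal_arg_Re; exact: a_arg.
have bRe n k l : (0 < n)%N -> (1 <= k < p.+1)%N -> (1 <= l < p.+1)%N ->
    0 <= complex.Re (b n k * conjc (b n l)).
  by move=> n0 hk hl; apply: principal_arg_Re; exact: b_arg.
pose G n k : R := (n%:R ^+ 2 + (n + 2 * k.-1)%:R ^+ 2) *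
    (normc (a n k) ^+ 2 + normc (b n k) ^+ 2).
have G0 n k : 0 <= G n k by rewrite mulr_ge0 ?addr_ge0 ?sqr_ge0.
have GS L : \sum_(1 <= i < L) \sum_(1 <= j < p.+1) G i j <= S0.
  exact: (almansi_parseval_le _ ha hb FE).
(* J_F(0) = 1 reads |a_{1,1}|^2 - |b_{1,1}|^2 = 1, so with weight 1 + 1 this term is at least 2,
   while 1 / (K + K') <= 1 because K >= 1. *)
have G11 : (K + K')^-1 <= G 1%N 1%N.
  have d0 : disc (0 : R[i]) by rewrite /disc /mkset normc0 ltr01.
  have [_ _ /(_ hp erefl)[Fz Fzb]] := almansi_wirtinger ha hb FE d0.
  move: JF0; rewrite /Jacobian_of Fz Fzb normc_conj => J.
  have KK : (K + K')^-1 <= 1 by rewrite invf_le1; lra.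
  rewrite /G /= muln0 addn0 expr1n; have := sqr_ge0 (normc (b 1%N 1%N)); lra.
have main n k : (0 < n)%N -> (1 <= k <= p)%N -> (n != 1%N) || (k != 1%N) ->
    G n k <= S0 - (K + K')^-1.
  move=> n0 hk nk; rewrite lerBrDl.
  apply: le_trans (double_sum_two_terms G0 n0 hk nk GS).
  by rewrite lerD2r.
have sq (x : R) : 0 <= x -> Num.sqrt x ^+ 2 = x by exact: sqr_sqrtr.
split.
- move=> n n2; have n0 : (0 < n)%N by apply: leq_trans n2.
  apply: (sum_normc_le_sqrt (normc_ge0 _) (normc_ge0 _) _ _ (main n 1%N n0 _ _)).
  + by rewrite ltr0n.
  (* For k = 1 the weight is exactly 2 n^2, hence the divisor n. *)
  + by rewrite /= muln0 addn0 mulr2n mulrDl mul1r.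
  + by rewrite leqnn hp.
  + by rewrite gtn_eqF.
- move=> n k n2 /andP[k2 kp]; have n0 : (0 < n)%N by apply: leq_trans n2.
  apply: (sum_normc_le_sqrt (normc_ge0 _) (normc_ge0 _) _ _ (main n k n0 _ _)).
  + by rewrite sqrtr_gt0 ltr0n.
  (* For n, k >= 2 the weight n^2 + (n + 2(k - 1))^2 is at least 4 + 16 = 2 * 10. *)
  + rewrite sq // -!natrX -!natrD -natrM ler_nat; nia.
  + by rewrite kp ltnW.
  + by rewrite gtn_eqF.
- move=> k /andP[k2 kp].
  apply: (sum_normc_le_sqrt (normc_ge0 _) (normc_ge0 _) _ _ (main 1%N k _ _ _)).
  + by rewrite sqrtr_gt0 ltr0n.
  (* For n = 1 and k >= 2 the weight is at least 1 + 9 = 2 * 5. *)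
  + rewrite sq // -!natrX -!natrD -natrM ler_nat; nia.
  + by [].
  + by rewrite kp ltnW.
  + by rewrite orbC gtn_eqF.
Qed.
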